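(* Let $r\ge 7$. There exists $d_0=d_0(r)$ such that for every $d\ge d_0$ there exists $\lambda\in[0,1]$ with $(r-1)d\lambda^2<1$ for which reconstruction is possible in $\mathrm{BOHT}(2,r,\lambda,d)$ (for integer $d$) and in $\mathrm{BOHT}(2,r,\lambda,\mathrm{Pois}(d))$.
   Context: For integer $r\ge2$ and $\lambda\in[0,1]$, $B_{r,\lambda}:\{\pm\}\to\{\pm\}^{r-1}$ is the kernel $B_{r,\lambda}(x_1,\dots,x_{r-1}|y)=\lambda+2^{-(r-1)}(1-\lambda)$ if $x_i=y$ for all $i$, and $2^{-(r-1)}(1-\lambda)$ otherwise. $\mathrm{BOHT}(2,r,\lambda,D)$ is the broadcasting model on a Galton–Watson $r$-uniform linear hypertree rooted at $\rho$ in which each vertex independently has $t\sim D$ downward hyperedges (each consisting of the vertex and $r-1$ new children); $\sigma_\rho\sim\mathrm{Unif}(\{\pm\})$, and given $\sigma_u$ the children's labels in each downward hyperedge of $u$ are drawn independently across hyperedges from $B_{r,\lambda}(\cdot|\sigma_u)$. $\mathrm{BOHT}(2,r,\lambda,d)$ means $D$ is the point mass at $d$ (every vertex has exactly $d$ downward hyperedges). Reconstruction is possible if $\lim_{k\to\infty}I(\sigma_\rho;T_k,\sigma_{L_k})>0$, where $T_k$ is the set of vertices at distance $\le k$ from $\rho$ and $L_k$ those at distance exactly $k$. *)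

(* Defs.v *)
From HB Require Import structures.
From mathcomp Require Import all_boot all_order all_algebra.
From mathcomp Require Import all_classical all_reals all_analysis.
Set Implicit Arguments. Unset Strict Implicit. Unset Printing Implicit Defensive.
Import Order.TTheory GRing.Theory Num.Theory.
Local Open Scope ring_scope.
Local Open Scope classical_set_scope.

(* Finite rooted r-uniform linear hypertrees (truncated at depth k).   *)
(* A vertex is a node carrying the list of its downward hyperedges;    *)
(* a downward hyperedge is the list of its r-1 children.               *)
Inductive htree : Type := HNode of seq (seq htree).

Definition hedges (t : htree) : seq (seq htree) := let: HNode es := t in es.

Fixpoint valid (r k : nat) (t : htree) : bool :=
  match k with
  | 0 => nilp (hedges t)
  | k'.+1 => all (fun e => (size e == r.-1) && all (valid r k') e) (hedges t)
  end.

Fixpoint nleaves (k : nat) (t : htree) : nat :=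
  match k with
  | 0 => 1
  | k'.+1 => sumn [seq sumn (map (nleaves k') e) | e <- hedges t]
  end.

Fixpoint blocks (ns : seq nat) (x : seq bool) : seq (seq bool) :=
  match ns with
  | [::] => [::]
  | n :: ns' => take n x :: blocks ns' (drop n x)
  end.

Section Broadcast.
Variable R : realType.

(* Labels: true = '+', false = '-'.                                     *)
Definition Bker (r : nat) (lam : R) (s : bool) (y : seq bool) : R :=
  (if all (fun b => b == s) y then lam else 0) + (1 - lam) / 2 ^+ r.-1.

(* P(sigma_{L_k} = x | sigma_rho = s, T_k = t), x listing the labels   *)
(* of L_k in DFS order.                                                 *)
Fixpoint condP (r : nat) (lam : R) (k : nat) (t : htree) (s : bool)
    (x : seq bool) : R :=
  match k with
  | 0 => (x == [:: s])%:R
  | k'.+1 =>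
    let es := hedges t in
    let xs := blocks [seq sumn (map (nleaves k') e) | e <- es] x in
    \prod_(ex <- zip es xs)
      \sum_(y : (r.-1).-tuple bool)
        (Bker r lam s y *
         \prod_(p <- zip (zip ex.1 y) (blocks (map (nleaves k') ex.1) ex.2))
            condP r lam k' p.1.1 p.1.2 p.2)
  end.

(* I(sigma_rho ; sigma_{L_k} | T_k = t), sigma_rho uniform on {+-},    *)
(* with the convention 0 log 0 = 0 (natural logarithm).                 *)
Definition treeMI (r : nat) (lam : R) (k : nat) (t : htree) : R :=
  \sum_(x : (nleaves k t).-tuple bool) \sum_(s : bool)
    (let p := condP r lam k t s x in
     let q := (condP r lam k t true x + condP r lam k t false x) / 2 in
     if p == 0 then 0 else (p / 2) * ln (p / q)).

(* P(T_k = t) for the Galton-Watson hypertree with offspring law D      *)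
(* (D n = probability that a vertex has n downward hyperedges).         *)
Fixpoint treeP (D : nat -> R) (k : nat) (t : htree) : R :=
  match k with
  | 0 => 1
  | k'.+1 => D (size (hedges t)) *
             \prod_(e <- hedges t) \prod_(c <- e) treeP D k' c
  end.

(* I(sigma_rho ; T_k, sigma_{L_k}) in BOHT(2, r, lam, D).               *)
(* Since sigma_rho is independent of T_k, this equals                   *)
(* sum_t P(T_k = t) I(sigma_rho ; sigma_{L_k} | T_k = t).               *)
Definition info (r : nat) (lam : R) (D : nat -> R) (k : nat) : \bar R :=
  \esum_(t in [set t : {classic htree} | valid r k t])
     ((treeP D k t) * treeMI r lam k t)%:E.

Definition reconstructible (r : nat) (lam : R) (D : nat -> R) : Prop :=
  exists2 l : \bar R, info r lam D k @[k --> \oo] --> l & (0 < l)%E.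

Definition pointmass (d : nat) : nat -> R := fun n => (n == d)%:R.

Definition poisson (d : R) : nat -> R :=
  fun n => expR (- d) * d ^+ n / (n`!)%:R.

End Broadcast.

(* Main.v *)
Require Import Defs.
From HB Require Import structures.
From mathcomp Require Import all_boot all_order all_algebra.
From mathcomp Require Import all_classical all_reals all_analysis.
From mathcomp Require Import ring lra.
Set Implicit Arguments. Unset Strict Implicit. Unset Printing Implicit Defensive.
Import Order.TTheory GRing.Theory Num.Theory numFieldNormedType.Exports.
Local Open Scope ring_scope.

(* A binary-input channel is recorded as the list of pairs (P(o|+), P(o|-)) over its
   outputs o. Passing from depth k to depth k+1 of the broadcasting model replaces the
   channel A seen at a child by: r-1 copies of A behind the kernel B (a hyperedge), then
   n independent hyperedges with probability D n. This operation is monotone for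
   comparison by sublinear functions of the pairs, which gives the data-processing
   inequality, hence the convergence of the mutual information.

   For the lower bound, chi2-information 3/5 is propagated from each level to the next.
   Dilute the channel so that it has chi2-information exactly a = 3/5, and let X_i be the
   resulting magnetizations of the r-1 children in a hyperedge. The statistic
   H = (prod (1 + X_i) - prod (1 - X_i)) / 2 has conditional mean lam q and second
   moment q + O(lam), where q = ((1+a)^(r-1) - (1-a)^(r-1)) / 2. Since
   q >= 1.39 (r-1) for r >= 7, the constraint lam^2 (r-1) d < 1 still allows
   n lam^2 q = 4/3 with n close to d. The test function f = e_1 / 2 - e_3 / 8, where e_k are
   the elementary symmetric functions of the values lam H over n hyperedges, only involves
   these two moments, and 2 E[sigma f] - E[f^2] is about 0.621 > a. Linear f = e_1 would
   suffice for r >= 8; the cubic correction is what reaches r = 7. *)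

(** * Product lists and sums over them *)

Section Sequences.
Variable T : Type.

Fixpoint alltup (n : nat) (A : seq T) : seq (seq T) :=
  if n is n'.+1 then [seq x :: s | x <- A, s <- alltup n' A] else [:: [::]].

Lemma big_alltupS (V : nmodType) n A (F : seq T -> V) :
  \sum_(s <- alltup n.+1 A) F s = \sum_(x <- A) \sum_(s <- alltup n A) F (x :: s).
Proof. exact: big_allpairs_dep. Qed.

Lemma sum_alltup_prod (K : comPzRingType) n A (F : T -> K) :
  \sum_(s <- alltup n A) \prod_(x <- s) F x = (\sum_(x <- A) F x) ^+ n.
Proof.
elim: n => [|n IH]; first by rewrite /= big_seq1 big_nil expr0.
rewrite big_alltupS exprS mulr_suml; apply: eq_bigr => x _.
by rewrite -IH mulr_sumr; apply: eq_bigr => s _; rewrite big_cons.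
Qed.

End Sequences.

Lemma alltup_map (T U : Type) (f : T -> U) n A :
  alltup n (map f A) = map (map f) (alltup n A).
Proof.
by elim: n => //= n ->; rewrite map_allpairs allpairs_mapl allpairs_mapr.
Qed.

Lemma mem_alltup (T : eqType) n (A : seq T) s :
  (s \in alltup n A) = (size s == n) && all (mem A) s.
Proof.
elim: n s => [|n IH] [|x s] //=.
- by apply/negbTE/allpairsP => -[[y t] [_ _]].
- apply/allpairsP/andP => [[[y t] /= [yA tA [-> ->]]]|[sn /andP[xA sA]]].
    by move: tA; rewrite IH => /andP[/eqP-> ->]; rewrite eqxx yA.
  by exists (x, s); split=> //=; rewrite IH -eqSS sn.
Qed.

Lemma alltup_uniq (T : eqType) n (A : seq T) : uniq A -> uniq (alltup n A).
Proof.
move=> uA; elim: n => //= n IH; apply: allpairs_uniq => //.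
by move=> [x s] [y t] _ _ /= [-> ->].
Qed.

Lemma all_alltup (T : eqType) (P : pred T) n A s :
  all P A -> s \in alltup n A -> all P s.
Proof.
move=> /allP PA; rewrite mem_alltup => /andP[_ /allP sA].
by apply/allP => x /sA /PA.
Qed.

(** Domination between measures passes to product measures, one coordinate at a time: the tail is
    changed by induction for a fixed head, then the head by the hypothesis. It serves to compare a
    truncated channel with its padded version. *)
Lemma ler_sum_alltup (K : numDomainType) (T : eqType) (P : pred T) n (A B : seq T)
    (F : seq T -> K) :
  all P A -> all P B ->
  (forall G : T -> K, (forall x, P x -> 0 <= G x) ->
     \sum_(x <- A) G x <= \sum_(x <- B) G x) ->
  (forall s, all P s -> 0 <= F s) ->
  \sum_(s <- alltup n A) F s <= \sum_(s <- alltup n B) F s.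
Proof.
move=> PA PB AB; elim: n F => [|n IH] F F0; first by rewrite /= !big_seq1.
rewrite !big_alltupS.
apply: (@le_trans _ _ (\sum_(x <- A) \sum_(s <- alltup n B) F (x :: s))).
  rewrite big_seq [leRHS]big_seq; apply: ler_sum => x xA; apply: IH => s Ps.
  by apply: F0; rewrite /= Ps (allP PA).
apply: AB => x Px; rewrite big_seq sumr_ge0 // => s sB.
by rewrite F0 //= Px (all_alltup PB sB).
Qed.

(** * Binary-input channels and their comparison by sublinear functions *)

Section Channels.
Variable R : realFieldType.
Implicit Types (lam : R) (D : nat -> R) (A B : seq (R * R)) (c : R * R).
Implicit Types (Phi : R -> R -> R).

Definition nonneg_pair c := (0 <= c.1) && (0 <= c.2).

Definition chsum Phi A : R := \sum_(c <- A) Phi c.1 c.2.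

(** Observations that are independent given the label: likelihoods multiply. *)
Definition prodpt (s : seq (R * R)) : R * R :=
  (\prod_(c <- s) c.1, \prod_(c <- s) c.2).

(* With probability lam all children copy the parent, otherwise their labels are
   independent and uniform. *)
Definition edgept (lam : R) (s : seq (R * R)) : R * R :=
  (lam * (\prod_(c <- s) c.1) + (1 - lam) * \prod_(c <- s) ((c.1 + c.2) / 2),
   lam * (\prod_(c <- s) c.2) + (1 - lam) * \prod_(c <- s) ((c.1 + c.2) / 2)).

Definition scalept (w : R) c : R * R := (w * c.1, w * c.2).

Definition edge m lam A := [seq edgept lam s | s <- alltup m A].

Definition node n A := [seq prodpt s | s <- alltup n A].

(* Since sublinear functions are homogeneous, the probability D n of the tree shape
   is absorbed into the pair. *)
Definition chan_step m lam (D : nat -> R) N A :=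
  flatten [seq [seq scalept (D n) c | c <- node n (edge m lam A)] | n <- iota 0 N].

(** [N] cuts the offspring law to fewer than [N] hyperedges, which keeps the list of outputs finite;
    the total mass may then drop below 1. At depth 0 the label itself is observed. *)
Fixpoint chan m lam D N k : seq (R * R) :=
  if k is k'.+1 then chan_step m lam D N (chan m lam D N k')
  else [:: (1, 0); (0, 1)].

(** Homogeneous convex functions on the quadrant, that is, integrands of f-divergences between the
    two output laws. Mutual information and chi2-information are both of this kind. *)
Record sublinear Phi : Prop := Sublinear {
  sublin_ge0 : forall x y, 0 <= x -> 0 <= y -> 0 <= Phi x y;
  sublinZ : forall w x y, 0 <= w -> 0 <= x -> 0 <= y ->
    Phi (w * x) (w * y) = w * Phi x y;
  sublinD : forall x y x' y', 0 <= x -> 0 <= y -> 0 <= x' -> 0 <= y' ->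
    Phi (x + x') (y + y') <= Phi x y + Phi x' y' }.

Lemma sublin00 Phi : sublinear Phi -> Phi 0 0 = 0.
Proof.
by move=> h; have := sublinZ h (lexx 0) (lexx 0) (lexx 0); rewrite !mul0r.
Qed.

Lemma sublinear_comp Phi (u v u' v' : R) : sublinear Phi ->
  0 <= u -> 0 <= v -> 0 <= u' -> 0 <= v' ->
  sublinear (fun x y => Phi (u * x + v * y) (u' * x + v' * y)).
Proof.
move=> h u0 v0 u'0 v'0; split=> [x y x0 y0|w x y w0 x0 y0|x y x' y' x0 y0 x'0 y'0].
- by apply: (sublin_ge0 h); rewrite addr_ge0 ?mulr_ge0.
- rewrite -(sublinZ h) // ?addr_ge0 ?mulr_ge0 //; congr (Phi _ _); ring.
- rewrite (_ : u * _ + _ = u * x + v * y + (u * x' + v * y')); last by ring.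
  rewrite (_ : u' * _ + _ = u' * x + v' * y + (u' * x' + v' * y')); last by ring.
  by apply: (sublinD h); rewrite addr_ge0 ?mulr_ge0.
Qed.

Lemma sublinear_eq Phi Psi :
  (forall x y, Phi x y = Psi x y) -> sublinear Phi -> sublinear Psi.
Proof.
by move=> e [h1 h2 h3]; split=> *; rewrite -!e; [exact: h1|exact: h2|exact: h3].
Qed.

(** For nonnegative lists of equal masses this is the Blackwell order: [A'] is a degraded version of
    [A]. *)
Definition dominates A A' :=
  forall Phi, sublinear Phi -> chsum Phi A' <= chsum Phi A.

Definition nonneg A := all nonneg_pair A.

Lemma nonneg_prod s : nonneg s ->
  [/\ 0 <= \prod_(c <- s) c.1, 0 <= \prod_(c <- s) c.2 &
      0 <= \prod_(c <- s) ((c.1 + c.2) / 2)].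
Proof.
move=> /allP s0; split; rewrite big_seq prodr_ge0 // => c /s0 /andP[c1 c2] //.
by rewrite divr_ge0 ?addr_ge0.
Qed.

Lemma nonneg_edgept lam s : 0 <= lam <= 1 -> nonneg s -> nonneg_pair (edgept lam s).
Proof.
move=> /andP[l0 l1] /nonneg_prod[p1 p2 p3].
by rewrite /nonneg_pair /= !addr_ge0 ?mulr_ge0 ?subr_ge0.
Qed.

Lemma nonneg_edge m lam A : 0 <= lam <= 1 -> nonneg A -> nonneg (edge m lam A).
Proof.
move=> l A0; apply/allP => _ /mapP[s sA ->].
exact/nonneg_edgept/(all_alltup A0 sA).
Qed.

Lemma nonneg_node n A : nonneg A -> nonneg (node n A).
Proof.
move=> A0; apply/allP => _ /mapP[s sA ->].
by have [p1 p2 _] := nonneg_prod (all_alltup A0 sA); rewrite /nonneg_pair p1 p2.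
Qed.

Lemma nonneg_step m lam D N A : 0 <= lam <= 1 -> (forall n, 0 <= D n) ->
  nonneg A -> nonneg (chan_step m lam D N A).
Proof.
move=> l D0 A0; apply/allP => _ /flatten_mapP[n _ /mapP[c cA ->]].
have /andP[c1 c2] := allP (nonneg_node n (nonneg_edge m l A0)) _ cA.
by rewrite /nonneg_pair !mulr_ge0.
Qed.

Lemma nonneg_chan m lam D N k : 0 <= lam <= 1 -> (forall n, 0 <= D n) ->
  nonneg (chan m lam D N k).
Proof.
move=> l D0; elim: k => [|k IH]; last exact: nonneg_step.
by rewrite /nonneg /= /nonneg_pair /= ler01 lexx.
Qed.

Lemma chsum_step m lam D N A Phi : 0 <= lam <= 1 -> (forall n, 0 <= D n) ->
  nonneg A ->
  (forall w x y, 0 <= w -> 0 <= x -> 0 <= y -> Phi (w * x) (w * y) = w * Phi x y) ->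
  chsum Phi (chan_step m lam D N A) =
  \sum_(0 <= n < N) D n * chsum Phi (node n (edge m lam A)).
Proof.
move=> l D0 A0 h; rewrite /chsum /chan_step big_flatten big_map /index_iota subn0.
apply: eq_bigr => n _; rewrite big_map mulr_sumr big_seq [RHS]big_seq.
apply: eq_bigr => c cA.
have /andP[c1 c2] := allP (nonneg_node n (nonneg_edge m l A0)) _ cA.
by rewrite h.
Qed.

(* Replacing the factors one at a time: each replacement only sees a sublinear
   function of the replaced factor. *)
Lemma hybrid (Psi : R -> R -> R -> R) n A A' :
  (forall p q t, 0 <= p -> 0 <= q -> 0 <= t ->
     sublinear (fun x y => Psi (p * x) (q * y) (t * ((x + y) / 2)))) ->
  nonneg A -> nonneg A' -> dominates A A' ->
  \sum_(s <- alltup n A') Psi (\prod_(c <- s) c.1) (\prod_(c <- s) c.2)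
     (\prod_(c <- s) ((c.1 + c.2) / 2)) <=
  \sum_(s <- alltup n A) Psi (\prod_(c <- s) c.1) (\prod_(c <- s) c.2)
     (\prod_(c <- s) ((c.1 + c.2) / 2)).
Proof.
move=> hPsi A0 A'0 AA'.
suff H p q t : 0 <= p -> 0 <= q -> 0 <= t ->
  \sum_(s <- alltup n A') Psi (p * \prod_(c <- s) c.1) (q * \prod_(c <- s) c.2)
     (t * \prod_(c <- s) ((c.1 + c.2) / 2)) <=
  \sum_(s <- alltup n A) Psi (p * \prod_(c <- s) c.1) (q * \prod_(c <- s) c.2)
     (t * \prod_(c <- s) ((c.1 + c.2) / 2)).
  have := H 1 1 1 ler01 ler01 ler01.
  by congr (_ <= _); apply: eq_bigr => s _; rewrite !mul1r.
elim: n p q t => [|n IH] p q t p0 q0 t0; first by rewrite /= !big_seq1 !big_nil.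
rewrite !big_alltupS exchange_big /=.
apply: (@le_trans _ _ (\sum_(s <- alltup n A') \sum_(x <- A)
    Psi (p * \prod_(c <- s) c.1 * x.1) (q * \prod_(c <- s) c.2 * x.2)
        (t * \prod_(c <- s) ((c.1 + c.2) / 2) * ((x.1 + x.2) / 2)))).
  rewrite big_seq [leRHS]big_seq; apply: ler_sum => s sA.
  have [p1 p2 p3] := nonneg_prod (all_alltup A'0 sA).
  have /AA' := hPsi _ _ _ (mulr_ge0 p0 p1) (mulr_ge0 q0 p2) (mulr_ge0 t0 p3).
  apply: le_trans; rewrite le_eqVlt; apply/orP; left; apply/eqP.
  by apply: eq_bigr => x _; rewrite !big_cons; congr Psi; ring.
rewrite exchange_big big_seq [leRHS]big_seq; apply: ler_sum => x xA.
have /andP[x1 x2] := allP A0 _ xA.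
have x3 : 0 <= (x.1 + x.2) / 2 by rewrite divr_ge0 ?addr_ge0.
have := IH _ _ _ (mulr_ge0 p0 x1) (mulr_ge0 q0 x2) (mulr_ge0 t0 x3).
congr (_ <= _); apply: eq_bigr => s _; rewrite ?big_cons; congr Psi; ring.
Qed.

(** With the other children fixed, the pair of the hyperedge is a linear image, with nonnegative
    coefficients, of the pair of one child. A sublinear function of it is thus sublinear in that
    child, and [hybrid] applies. *)
Lemma dominates_edge m lam A A' : 0 <= lam <= 1 -> nonneg A -> nonneg A' ->
  dominates A A' -> dominates (edge m lam A) (edge m lam A').
Proof.
move=> /andP[l0 l1] A0 A'0 AA' Phi h; rewrite /chsum !big_map.
pose Psi p q t := Phi (lam * p + (1 - lam) * t) (lam * q + (1 - lam) * t).
apply: (@hybrid Psi) => // p q t p0 q0 t0; rewrite /Psi.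
have l1' : 0 <= 1 - lam by rewrite subr_ge0.
have h' : 0 <= (1 - lam) * t / 2 by rewrite divr_ge0 ?mulr_ge0.
apply: (@sublinear_eq (fun x y => Phi
   ((lam * p + (1 - lam) * t / 2) * x + (1 - lam) * t / 2 * y)
   ((1 - lam) * t / 2 * x + (lam * q + (1 - lam) * t / 2) * y))).
  by move=> x y; congr Phi; field.
by apply: sublinear_comp; rewrite ?addr_ge0 ?mulr_ge0 ?invr_ge0 ?ler0n.
Qed.

Lemma dominates_node n A A' : nonneg A -> nonneg A' ->
  dominates A A' -> dominates (node n A) (node n A').
Proof.
move=> A0 A'0 AA' Phi h; rewrite /chsum !big_map.
apply: (@hybrid (fun p q _ => Phi p q)) => // p q t p0 q0 t0.
apply: (@sublinear_eq (fun x y => Phi (p * x + 0 * y) (0 * x + q * y))).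
  by move=> x y; rewrite !mul0r addr0 add0r.
exact: sublinear_comp.
Qed.

Lemma dominates_step m lam D N A A' : 0 <= lam <= 1 -> (forall n, 0 <= D n) ->
  nonneg A -> nonneg A' ->
  dominates A A' -> dominates (chan_step m lam D N A) (chan_step m lam D N A').
Proof.
move=> l D0 A0 A'0 AA' Phi h; rewrite !chsum_step //; try exact: sublinZ.
apply: ler_sum => n _; apply: ler_wpM2l => //.
by apply: dominates_node h; rewrite ?nonneg_edge //; exact: dominates_edge.
Qed.

End Channels.

(** * Label symmetry, total mass and data processing *)

Section Masses.
Variable R : realFieldType.
Implicit Types (lam : R) (D : nat -> R) (A B : seq (R * R)) (c : R * R).
Implicit Types (Phi : R -> R -> R).

Definition mass1 A : R := \sum_(c <- A) c.1.
Definition mass2 A : R := \sum_(c <- A) c.2.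

(** The symmetry between + and -, expressed through sums so that no permutation of the outputs has
    to be exhibited. *)
Definition swap_invariant A :=
  forall F : R * R -> R, \sum_(c <- A) F c = \sum_(c <- A) F (c.2, c.1).

Lemma swap_mass A : swap_invariant A -> mass2 A = mass1 A.
Proof. by move=> sA; rewrite /mass2 sA. Qed.

Lemma swap_alltup n A (F : seq (R * R) -> R) : swap_invariant A ->
  \sum_(s <- alltup n A) F s =
  \sum_(s <- alltup n A) F [seq (c.2, c.1) | c : R * R <- s].
Proof.
move=> sA; elim: n F => [|n IH] F; first by rewrite /= !big_seq1.
rewrite !big_alltupS sA; apply: eq_bigr => x _; exact: IH.
Qed.

Lemma swap_edge m lam A : swap_invariant A -> swap_invariant (edge m lam A).
Proof.
move=> sA F; rewrite !big_map (swap_alltup m _ sA); apply: eq_bigr => s _.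
rewrite /edgept !big_map /=; congr (F (_, _)); congr (_ + _ * _);
  by apply: eq_bigr => c _; rewrite addrC.
Qed.

Lemma swap_node n A : swap_invariant A -> swap_invariant (node n A).
Proof.
move=> sA F; rewrite !big_map (swap_alltup n _ sA); apply: eq_bigr => s _.
by rewrite /prodpt !big_map.
Qed.

Lemma swap_step m lam D N A : swap_invariant A -> swap_invariant (chan_step m lam D N A).
Proof.
move=> sA F; rewrite /chan_step !big_flatten !big_map; apply: eq_bigr => n _.
by rewrite [LHS]big_map [RHS]big_map [LHS](swap_node n (swap_edge m lam sA)).
Qed.

Lemma swap_chan m (lam : R) D N k : swap_invariant (chan m lam D N k).
Proof.
elim: k => [|k IH]; last exact: swap_step.
by move=> F /=; rewrite !big_cons !big_nil !addr0 addrC.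
Qed.

Lemma mass1_edge m lam A : swap_invariant A ->
  mass1 (edge m lam A) = mass1 A ^+ m.
Proof.
move=> sA; rewrite /mass1 big_map /= big_split /= -!mulr_sumr !sum_alltup_prod.
rewrite -mulr_suml big_split /= -/(mass1 A) -/(mass2 A) swap_mass //.
rewrite (_ : (_ + _) / 2 = mass1 A); first by ring.
by field.
Qed.

Lemma mass1_node n A : mass1 (node n A) = mass1 A ^+ n.
Proof. by rewrite /mass1 big_map sum_alltup_prod. Qed.

Lemma mass1_step m lam D N A : 0 <= lam <= 1 -> (forall n, 0 <= D n) ->
  nonneg A -> swap_invariant A ->
  mass1 (chan_step m lam D N A) = \sum_(0 <= n < N) D n * (mass1 A ^+ m) ^+ n.
Proof.
move=> l D0 A0 sA; rewrite [LHS](@chsum_step _ m lam D N A (fun x _ => x)) //.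
by apply: eq_bigr => n _; rewrite -[chsum _ _]/(mass1 _) mass1_node mass1_edge.
Qed.

(** Jensen's inequality: merging all outputs into one loses information. *)
Lemma sublin_sum Phi A : sublinear Phi -> nonneg A ->
  Phi (mass1 A) (mass2 A) <= chsum Phi A.
Proof.
move=> h; rewrite /mass1 /mass2 /chsum.
elim: A => [|c A IH] /=; first by rewrite !big_nil sublin00.
move=> /andP[/andP[c1 c2] A0]; rewrite !big_cons.
apply: le_trans (lerD (lexx _) (IH A0)); apply: (sublinD h) => //;
  rewrite big_seq sumr_ge0 // => x /(allP A0) /andP[] //.
Qed.

(** Each pair splits as [c.1] times (1, 0) plus [c.2] times (0, 1): no channel beats revealing the
    label. *)
Lemma dominates_full Phi A : sublinear Phi -> nonneg A ->
  chsum Phi A <= mass1 A * Phi 1 0 + mass2 A * Phi 0 1.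
Proof.
move=> h A0; rewrite /chsum /mass1 /mass2 !mulr_suml -big_split /=.
rewrite big_seq [leRHS]big_seq; apply: ler_sum => c /(allP A0) /andP[c1 c2].
rewrite -!(sublinZ h) // !mulr1 !mulr0.
by have := sublinD h c1 (lexx 0) (lexx 0) c2; rewrite addr0 add0r.
Qed.

Lemma chsum_ge0 Phi A : sublinear Phi -> nonneg A -> 0 <= chsum Phi A.
Proof.
move=> h A0; rewrite /chsum big_seq sumr_ge0 // => c /(allP A0) /andP[].
exact: sublin_ge0.
Qed.

(** Depth 0 reveals the label, hence dominates depth 1, whose mass is at most 1. Monotonicity of the
    step carries this to every depth. *)
Lemma dominates_chan m (lam : R) (D : nat -> R) N k : 0 <= lam <= 1 -> (forall n, 0 <= D n) ->
  \sum_(0 <= n < N) D n <= 1 ->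
  dominates (chan m lam D N k) (chan m lam D N k.+1).
Proof.
move=> l D0 D1; elim: k => [|k IH]; last first.
  exact: (dominates_step m N l D0 (nonneg_chan m N k l D0) (nonneg_chan m N k.+1 l D0) IH).
move=> Phi h; have n1 := nonneg_chan m N 1 l D0; have n0 := nonneg_chan m N 0 l D0.
apply: le_trans (dominates_full h n1) _.
rewrite swap_mass; last exact: swap_chan.
have -> : mass1 (chan m lam D N 1) = \sum_(0 <= n < N) D n.
  rewrite mass1_step //; last exact: (swap_chan m lam D N 0).
  by apply: eq_bigr => n _; rewrite /mass1 !big_cons big_nil /= !addr0 !expr1n mulr1.
rewrite /chsum !big_cons big_nil /= addr0 -mulrDr ler_piMl //.
by rewrite addr_ge0 ?(sublin_ge0 h).
Qed.

(** An additional hyperedge cannot hurt: since [B] has mass 1, averaging over its output returns the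
    previous pair, and Jensen's inequality applies. *)
Lemma node_le n n' B Phi : sublinear Phi -> nonneg B -> mass1 B = 1 ->
  mass2 B = 1 -> (n <= n')%N -> chsum Phi (node n B) <= chsum Phi (node n' B).
Proof.
move=> h B0 m1 m2 /subnK <-; elim: (n' - n)%N => // k IH.
apply: le_trans IH _; rewrite addSn /chsum !big_map /= big_alltupS exchange_big /=.
rewrite big_seq [leRHS]big_seq; apply: ler_sum => s sB.
have [p1 p2 _] := nonneg_prod (all_alltup B0 sB).
set x := \prod_(c <- s) c.1 in p1 *; set y := \prod_(c <- s) c.2 in p2 *.
have hc : sublinear (fun u v => Phi (x * u + 0 * v) (0 * u + y * v)).
  exact: sublinear_comp.
have := sublin_sum hc B0; rewrite m1 m2 !mul0r !addr0 !add0r !mulr1.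
move/le_trans; apply; rewrite /chsum le_eqVlt; apply/orP; left; apply/eqP.
apply: eq_bigr => c _; rewrite !big_cons -/x -/y; congr Phi; ring.
Qed.

End Masses.

(** * Moments of elementary symmetric functions of independent samples *)

Section SymmetricFunctions.
Variables (R : realFieldType) (T : Type).
Implicit Types (h w : T -> R) (L : seq T) (s : seq T).

Fixpoint esym h (k : nat) s : R :=
  if s is x :: s' then
    esym h k s' + (if k is k'.+1 then h x * esym h k' s' else 0)
  else (k == 0)%:R.

Lemma esym0 h s : esym h 0 s = 1.
Proof. by elim: s => //= x s ->; rewrite addr0. Qed.

Lemma esymN h k s : esym (fun x => - h x) k s = (-1) ^+ k * esym h k s.
Proof.
elim: s k => [|x s IH] [|k] //=; rewrite ?mulr1 ?mulr0 //.
- by rewrite !addr0 IH.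
- rewrite !IH exprS; ring.
Qed.

(** When [w] has sum 1, the expectation of [F] over [n] independent draws. *)
Definition wsum w n L (F : seq T -> R) : R :=
  \sum_(s <- alltup n L) (\prod_(x <- s) w x) * F s.

(** Expand both factors by whether they use the first sample, then average over that sample: one use
    yields [mu], two uses yield [beta]. *)
Lemma wsum_esymM w h L mu beta n i j :
  \sum_(x <- L) w x = 1 -> \sum_(x <- L) w x * h x = mu ->
  \sum_(x <- L) w x * h x ^+ 2 = beta ->
  wsum w n.+1 L (fun s => esym h i s * esym h j s) =
  wsum w n L (fun s => esym h i s * esym h j s) +
  mu * ((if i is i'.+1 then wsum w n L (fun s => esym h i' s * esym h j s) else 0)
      + (if j is j'.+1 then wsum w n L (fun s => esym h i s * esym h j' s) else 0)) +
  beta * (if i is i'.+1 then if j is j'.+1 then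
            wsum w n L (fun s => esym h i' s * esym h j' s) else 0 else 0).
Proof.
move=> w1 wh wh2; rewrite /wsum big_alltupS exchange_big /=.
pose W s := \prod_(x <- s) w x.
pose a s := if i is i'.+1 then esym h i' s else 0.
pose b s := if j is j'.+1 then esym h j' s else 0.
have -> : \sum_(s <- alltup n L) \sum_(x <- L)
   \prod_(y <- (x :: s)) w y * (esym h i (x :: s) * esym h j (x :: s)) =
   \sum_(s <- alltup n L) (W s * (esym h i s * esym h j s) +
      mu * (W s * (a s * esym h j s) + W s * (esym h i s * b s)) +
      beta * (W s * (a s * b s))).
  apply: eq_bigr => s _; rewrite -wh2 -wh.
  have -> : W s * (esym h i s * esym h j s) =
      \sum_(x <- L) w x * (W s * (esym h i s * esym h j s)).
    by rewrite -mulr_suml w1 mul1r.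
  rewrite !mulr_suml -!big_split /=; apply: eq_bigr => x _.
  rewrite big_cons -/(W s).
  have e (k : nat) : (if k is k'.+1 then h x * esym h k' s else 0) =
     h x * (if k is k'.+1 then esym h k' s else 0).
    by case: k => [|k] //=; rewrite mulr0.
  rewrite !e -/(a s) -/(b s); ring.
rewrite !big_split /= -!mulr_sumr big_split /=.
congr (_ + _ * (_ + _) + _ * _); rewrite /a /b.
- by case: i {a} => // ; rewrite big1 // => s _; rewrite mul0r mulr0.
- by case: j {b} => // ; rewrite big1 // => s _; rewrite !mulr0.
- case: i {a} => [|i]; first by rewrite big1 // => s _; rewrite mul0r mulr0.
  by case: j {b} => // ; rewrite big1 // => s _; rewrite !mulr0.
Qed.

Lemma wsum_esym0 w h L i j :
  wsum w 0 L (fun s => esym h i s * esym h j s) = (i == 0)%:R * (j == 0)%:R.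
Proof. by rewrite /wsum /= big_seq1 big_nil mul1r. Qed.

Section Moments.
Variables (w h : T -> R) (L : seq T) (mu beta : R).
Hypotheses (w1 : \sum_(x <- L) w x = 1) (wh : \sum_(x <- L) w x * h x = mu).
Hypothesis wh2 : \sum_(x <- L) w x * h x ^+ 2 = beta.

Let M n i j := wsum w n L (fun s => esym h i s * esym h j s).
(** The falling factorial, taken in [R] so that it vanishes for [n < k] without truncated
    subtraction. *)
Let ff (n k : nat) : R := \prod_(0 <= i < k) (n%:R - i%:R).

(* The coefficient of u^i v^j in (1 + mu u + mu v + beta u v)^n. *)
Lemma moments n :
  [/\ M n 0 1 = ff n 1 * mu,
      M n 0 3 = ff n 3 * mu ^+ 3 / 6,
      M n 1 1 = ff n 1 * beta + ff n 2 * mu ^+ 2,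
      M n 1 3 = ff n 3 * beta * mu ^+ 2 / 2 + ff n 4 * mu ^+ 4 / 6 &
      M n 3 3 = ff n 3 * beta ^+ 3 / 6 + ff n 4 * beta ^+ 2 * mu ^+ 2 / 2
                + ff n 5 * beta * mu ^+ 4 / 4 + ff n 6 * mu ^+ 6 / 36].
Proof.
(* The recurrence for a pair of indices calls on smaller ones, so all ten moments with indices at
   most 3 go through one induction. *)
suff: [/\ [/\ M n 0 0 = 1, M n 0 1 = ff n 1 * mu,
          M n 0 2 = ff n 2 * mu ^+ 2 / 2 & M n 0 3 = ff n 3 * mu ^+ 3 / 6],
      [/\ M n 1 1 = ff n 1 * beta + ff n 2 * mu ^+ 2,
          M n 1 2 = ff n 2 * beta * mu + ff n 3 * mu ^+ 3 / 2 &
          M n 1 3 = ff n 3 * beta * mu ^+ 2 / 2 + ff n 4 * mu ^+ 4 / 6],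
      [/\ M n 2 2 = ff n 2 * beta ^+ 2 / 2 + ff n 3 * beta * mu ^+ 2
                    + ff n 4 * mu ^+ 4 / 4 &
          M n 2 3 = ff n 3 * beta ^+ 2 * mu / 2 + ff n 4 * beta * mu ^+ 3 / 2
                    + ff n 5 * mu ^+ 5 / 12] &
      M n 3 3 = ff n 3 * beta ^+ 3 / 6 + ff n 4 * beta ^+ 2 * mu ^+ 2 / 2
                + ff n 5 * beta * mu ^+ 4 / 4 + ff n 6 * mu ^+ 6 / 36].
  by case=> -[_ ? _ ?] [? _ ?] _ ?; split.
have Mrec k i j : M k.+1 i j = _ := wsum_esymM k i j w1 wh wh2.
have Msym k i j : M k i j = M k j i.
  by apply: eq_bigr => s _; rewrite [_ * esym h j s]mulrC.
have ffE k l : ff k l = \prod_(0 <= i < l) (k%:R - i%:R) by [].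
elim: n => [|n [[h00 h01 h02 h03] [h11 h12 h13] [h22 h23] h33]].
  rewrite /M !wsum_esym0 /= !ffE !big_nat_recl //= !subrr.
  by split; [split|split|split|]; rewrite ?mul0r ?mul1r ?mulr0 ?addr0.
rewrite !Mrec /= -/(M _ _ _) -/(M _ _ _).
have Mf i j : wsum w n L (fun s => esym h i s * esym h j s) = M n i j by [].
rewrite !Mf ?[M n 1 0]Msym ?[M n 2 0]Msym ?[M n 2 1]Msym ?[M n 3 0]Msym
  ?[M n 3 1]Msym ?[M n 3 2]Msym.
rewrite h00 h01 h02 h03 h11 h12 h13 h22 h23 h33 !ffE.
rewrite !unlock /= -natr1.
by split; [split|split|split|]; field.
Qed.

End Moments.
End SymmetricFunctions.

(** * Numerical value of the estimator and moments of a single hyperedge *)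

Section OneStep.
Variable R : realFieldType.

(** Here [x] stands for [1 / n], [z] for [n beta], and [gk] for the falling factorial of order k
    divided by [n ^ k]. The value near 0.621 leaves room for the errors in [x] and [z]. *)
Lemma estimator_bound (x z : R) (g2 := 1 - x) (g3 := g2 * (1 - 2 * x))
    (g4 := g3 * (1 - 3 * x)) (g5 := g4 * (1 - 4 * x)) (g6 := g5 * (1 - 5 * x)) :
  0 <= x <= 1 / 200 -> `|z - 4 / 3| <= 1 / 200 ->
  61 / 100 <= 4 / 3 - g3 * (8 / 81) - (z / 4 + g2 * (4 / 9))
     + (g3 * z / 9 + g4 * (16 / 243))
     - (g3 * (z ^+ 3 / 6) + g4 * (z ^+ 2 * (8 / 9)) + g5 * (z * (64 / 81))
        + g6 * (32 / 81 * (32 / 81))) / 64.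
Proof.
move=> /andP[x0 x1]; rewrite ler_norml => /andP[z0' z1'].
have z0 : 4 / 3 - 1 / 200 <= z by move: z0'; clear; lra.
have z1 : z <= 134 / 100 by move: z1'; clear; lra.
have z00 : 0 <= z by apply: le_trans z0; clear; lra.
have B (k : R) : 0 <= k <= 5 -> 0 <= 1 - k * x <= 1 by move: x0 x1; clear; nra.
have G (g y : R) : 0 <= g <= 1 -> 0 <= y <= 1 -> 0 <= g * y <= 1.
  by move=> /andP[? ?] /andP[? ?]; rewrite mulr_ge0 //= mulr_ile1.
have b1 : 0 <= g2 <= 1 by rewrite /g2 -[x]mul1r; apply: B; clear; lra.
have b3 : 0 <= g3 <= 1 by apply: G => //; apply: B; clear; lra.
have b4 : 0 <= g4 <= 1 by apply: G => //; apply: B; clear; lra.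
have b5 : 0 <= g5 <= 1 by apply: G => //; apply: B; clear; lra.
have b6 : 0 <= g6 <= 1 by apply: G => //; apply: B; clear; lra.
(* Only [g3] and [g4] occur in positive terms and need lower bounds; in the negative terms each
   factor is replaced by 1. *)
have L3 : 1 - 3 * x <= g3 by rewrite /g3 /g2; move: (sqr_ge0 x); clear; lra.
have L4 : 1 - 6 * x <= g4.
  apply: (@le_trans _ _ ((1 - 3 * x) * (1 - 3 * x))).
    by move: (sqr_ge0 x); clear; lra.
  by apply: ler_wpM2r L3; case/andP: (B 3 ltac:(clear; lra)).
have U (g y b : R) : 0 <= g <= 1 -> 0 <= y -> y <= b -> g * y <= b.
  by move=> /andP[? ?] ? ?; apply: le_trans (ler_piMl _ _) _.
have zz : z ^+ 2 <= 18 / 10.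
  by move: (ler_pM z00 z00 z1 z1); rewrite -expr2; move/le_trans; apply; clear; lra.
have zzz : z ^+ 3 <= 2412 / 1000.
  have := ler_pM (sqr_ge0 z) z00 zz z1; rewrite -exprSr.
  by move/le_trans; apply; clear; lra.
have U3 := U _ (8 / 81) _ b3 _ (lexx _).
have U2 := U _ (4 / 9) _ b1 _ (lexx _).
have V3 : g3 * (z ^+ 3 / 6) <= 402 / 1000.
  by apply: U => //; [rewrite divr_ge0 ?exprn_ge0 //|move: zzz; clear; lra].
have V4 : g4 * (z ^+ 2 * (8 / 9)) <= 16 / 10.
  by apply: U => //; [rewrite mulr_ge0 ?sqr_ge0 ?divr_ge0|move: zz; clear; lra].
have V5 : g5 * (z * (64 / 81)) <= 106 / 100.
  by apply: U => //; [rewrite mulr_ge0 ?divr_ge0|move: z1; clear; lra].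
have V6 : g6 * (32 / 81 * (32 / 81)) <= 16 / 100.
  by apply: U => //; clear; lra.
have W3 : (1 - 3 * x) * z <= g3 * z by apply: ler_wpM2r.
have W3' : z - x * (402 / 100) <= (1 - 3 * x) * z.
  by move: (ler_wpM2l x0 z1); clear; lra.
have {}U3 : g3 * (8 / 81) <= 8 / 81 by apply: U3; clear; lra.
have {}U2 : g2 * (4 / 9) <= 4 / 9 by apply: U2; clear; lra.
by move: z0 z1 x1 L4 U3 U2 V3 V4 V5 V6 W3 W3'; clear; lra.
Qed.

(* In the limit of many hyperedges, with n mu and n beta both tending to 4/3, the
   moments of the two elementary symmetric functions are polynomials in 4/3 and
   the left-hand side below is about 0.621. *)
Lemma estimator_value (T : Type) (w h : T -> R) (L : seq T) (mu beta : R) n :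
  \sum_(x <- L) w x = 1 -> \sum_(x <- L) w x * h x = mu ->
  \sum_(x <- L) w x * h x ^+ 2 = beta ->
  (200 <= n)%N -> n%:R * mu = 4 / 3 -> `|n%:R * beta - 4 / 3| <= 1 / 200 ->
  61 / 100 <= wsum w n L (fun s => 2 * (esym h 1 s / 2 - esym h 3 s / 8)
                                   - (esym h 1 s / 2 - esym h 3 s / 8) ^+ 2).
Proof.
move=> w1 wh wh2 n200 nmu nbeta.
have [M01 M03 M11 M13 M33] := moments w1 wh wh2 n.
set M := wsum w n L in M01 M03 M11 M13 M33 *.
have -> : M (fun s => 2 * (esym h 1 s / 2 - esym h 3 s / 8)
                      - (esym h 1 s / 2 - esym h 3 s / 8) ^+ 2) =
   M (fun s => esym h 0 s * esym h 1 s) - M (fun s => esym h 0 s * esym h 3 s) / 4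
   - M (fun s => esym h 1 s * esym h 1 s) / 4
   + M (fun s => esym h 1 s * esym h 3 s) / 8
   - M (fun s => esym h 3 s * esym h 3 s) / 64.
  rewrite /M /wsum !mulr_suml -!sumrN -!big_split /=; apply: eq_bigr => s _.
  by rewrite !esym0; field.
rewrite M01 M03 M11 M13 M33 !unlock /= {M M01 M03 M11 M13 M33}.
have n0 : 0 < n%:R :> R by rewrite ltr0n (leq_trans _ n200).
set N : R := n%:R in nmu nbeta n0 *.
have N200 : 200 <= N by rewrite /N ler_nat.
have Nn0 : N != 0 by rewrite gt_eqF.
have x01 : 0 <= N^-1 <= 1 / 200.
  by rewrite invr_ge0 ltW //= div1r lef_pV2 ?posrE.
have muE : mu = 4 / 3 * N^-1 by rewrite -nmu; field.
have betaE : beta = N * beta * N^-1 by field.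
have := estimator_bound x01 nbeta; congr (_ <= _).
move: betaE; set z := N * beta; clearbody z => ->; rewrite muE; field; exact: Nn0.
Qed.

(** [u] is the output law of a child given the parent's label, [v] the average law, [g] the
    magnetization. Moments factor over the children: the copying part yields the mean, as the
    independent part cancels there; the independent part yields the main term of the second
    moment. *)
Lemma edge_moments (T : eqType) (A : seq T) (u v g : T -> R) (a lam : R) m
  (W := fun s : seq T => lam * (\prod_(c <- s) u c) + (1 - lam) * \prod_(c <- s) v c)
  (h := fun s : seq T => lam * ((\prod_(c <- s) (1 + g c) - \prod_(c <- s) (1 - g c)) / 2))
  (q := ((1 + a) ^+ m - (1 - a) ^+ m) / 2) :
  0 <= lam -> 0 <= a <= 1 ->
  (forall c, c \in A -> 0 <= u c) -> (forall c, c \in A -> `|g c| <= 1) ->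
  \sum_(c <- A) u c = 1 -> \sum_(c <- A) u c * g c = a ->
  \sum_(c <- A) v c = 1 -> \sum_(c <- A) v c * g c = 0 ->
  \sum_(c <- A) v c * g c ^+ 2 = a ->
  [/\ \sum_(s <- alltup m A) W s = 1,
      \sum_(s <- alltup m A) W s * h s = lam ^+ 2 * q &
      `|\sum_(s <- alltup m A) W s * h s ^+ 2 - lam ^+ 2 * q| <= lam ^+ 3 * 4 ^+ m].
Proof.
move=> l0 /andP[a0 a1] u0 g1 su sug sv svg svg2.
have uS (F : T -> R) : \sum_(s <- alltup m A) (\prod_(c <- s) u c) * (\prod_(c <- s) F c) =
    (\sum_(c <- A) u c * F c) ^+ m.
  by rewrite -sum_alltup_prod; apply: eq_bigr => s _; rewrite big_split.
have vS (F : T -> R) : \sum_(s <- alltup m A) (\prod_(c <- s) v c) * (\prod_(c <- s) F c) =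
    (\sum_(c <- A) v c * F c) ^+ m.
  by rewrite -sum_alltup_prod; apply: eq_bigr => s _; rewrite big_split.
(* The second moment under copying enters with weight [lam ^+ 3], so a crude bound on it
   suffices. *)
pose X := \sum_(s <- alltup m A) (\prod_(c <- s) u c) *
   ((\prod_(c <- s) (1 + g c) - \prod_(c <- s) (1 - g c)) / 2) ^+ 2.
have q0 : 0 <= q.
  by rewrite divr_ge0 // subr_ge0 lerXn2r ?nnegrE; lra.
have q4 : q <= 4 ^+ m.
  have : (1 + a) ^+ m <= 4 ^+ m by apply: lerXn2r; rewrite ?nnegrE; lra.
  have : 0 <= (1 - a) ^+ m by apply: exprn_ge0; lra.
  have : 0 <= 4 ^+ m :> R by apply: exprn_ge0.
  by rewrite /q; lra.
have gb c : c \in A -> -1 <= g c <= 1 by move=> /g1; rewrite ler_norml.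
have X0 : 0 <= X <= 4 ^+ m.
  rewrite /X big_seq; apply/andP; split.
    rewrite sumr_ge0 // => s; rewrite mem_alltup => /andP[_ /allP sA].
    by rewrite mulr_ge0 ?sqr_ge0 // big_seq prodr_ge0 // => c /sA /u0.
  apply: (@le_trans _ _ (\sum_(s <- alltup m A) \prod_(c <- s) u c * 4 ^+ m)); last first.
    by rewrite -mulr_suml sum_alltup_prod su expr1n mul1r.
  rewrite [leRHS]big_seq; apply: ler_sum => s; rewrite mem_alltup => /andP[/eqP sz /allP sA].
  apply: ler_wpM2l; first by rewrite big_seq prodr_ge0 // => c /sA /u0.
  have P (F : T -> R) : (forall c, c \in A -> 0 <= F c <= 2) ->
      0 <= \prod_(c <- s) F c <= 2 ^+ m.
    move=> F2; rewrite -sz; elim: (s) sA => [|c s' IH] sA.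
      by rewrite big_nil expr0 ler01 lexx.
    have /F2 /andP[c0 c2] := sA c (mem_head _ _).
    have /andP[p0 p2] := IH (fun d ds => sA d (@mem_behead _ (c :: s') d ds)).
    by rewrite big_cons exprS mulr_ge0 // ler_pM.
  have /andP[p1 p2] := P (fun c => 1 + g c) ltac:(by move=> c /gb; lra).
  have /andP[p3 p4] := P (fun c => 1 - g c) ltac:(by move=> c /gb; lra).
  rewrite (_ : 4 = 2 * 2); last by ring.
  rewrite [leRHS]exprMn; move: p1 p2 p3 p4; set y := \prod_(c <- s) _.
  set y' := \prod_(c <- s) _; set t := 2 ^+ m => p1 p2 p3 p4.
  have : 0 <= (t - (y - y') / 2) * (t + (y - y') / 2) by apply: mulr_ge0; lra.
  by lra.
have lin (p F : T -> R) (x y z : R) : (forall c, F c = x + y * g c + z * g c ^+ 2) ->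
    \sum_(c <- A) p c * F c = x * (\sum_(c <- A) p c)
      + y * (\sum_(c <- A) p c * g c) + z * (\sum_(c <- A) p c * g c ^+ 2).
  move=> FE; rewrite !mulr_sumr -!big_split; apply: eq_bigr => c _ /=.
  by rewrite FE; ring.
have Eu1 : \sum_(c <- A) u c * (1 + g c) = 1 + a.
  by rewrite (lin _ _ 1 1 0) ?su ?sug => [|c]; ring.
have Eu2 : \sum_(c <- A) u c * (1 - g c) = 1 - a.
  by rewrite (lin _ _ 1 (-1) 0) ?su ?sug => [|c]; ring.
have Ev1 : \sum_(c <- A) v c * (1 + g c) = 1.
  by rewrite (lin _ _ 1 1 0) ?sv ?svg => [|c]; ring.
have Ev2 : \sum_(c <- A) v c * (1 - g c) = 1.
  by rewrite (lin _ _ 1 (-1) 0) ?sv ?svg => [|c]; ring.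
have Ev3 : \sum_(c <- A) v c * (1 + g c) ^+ 2 = 1 + a.
  by rewrite (lin _ _ 1 2 1) ?sv ?svg ?svg2 => [|c]; ring.
have Ev4 : \sum_(c <- A) v c * (1 - g c) ^+ 2 = 1 + a.
  by rewrite (lin _ _ 1 (-2) 1) ?sv ?svg ?svg2 => [|c]; ring.
have Ev5 : \sum_(c <- A) v c * ((1 + g c) * (1 - g c)) = 1 - a.
  by rewrite (lin _ _ 1 0 (-1)) ?sv ?svg ?svg2 => [|c]; ring.
split.
- rewrite big_split /= -!mulr_sumr !sum_alltup_prod su sv !expr1n; ring.
- have -> : \sum_(s <- alltup m A) W s * h s = \sum_(s <- alltup m A)
     (lam ^+ 2 / 2 * ((\prod_(c <- s) u c) * \prod_(c <- s) (1 + g c))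
      - lam ^+ 2 / 2 * ((\prod_(c <- s) u c) * \prod_(c <- s) (1 - g c))
      + ((1 - lam) * lam / 2 * ((\prod_(c <- s) v c) * \prod_(c <- s) (1 + g c))
      - (1 - lam) * lam / 2 * ((\prod_(c <- s) v c) * \prod_(c <- s) (1 - g c)))).
    by apply: eq_bigr => s _; rewrite /W /h; field.
  rewrite !big_split /= !sumrN -!mulr_sumr !uS !vS Eu1 Eu2 Ev1 Ev2 /q.
  by field.
- have -> : \sum_(s <- alltup m A) W s * h s ^+ 2 = \sum_(s <- alltup m A)
     (lam ^+ 3 * ((\prod_(c <- s) u c) *
        ((\prod_(c <- s) (1 + g c) - \prod_(c <- s) (1 - g c)) / 2) ^+ 2)
      + ((1 - lam) * lam ^+ 2 / 4 * ((\prod_(c <- s) v c) * \prod_(c <- s) (1 + g c) ^+ 2)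
      + (1 - lam) * lam ^+ 2 / 4 * ((\prod_(c <- s) v c) * \prod_(c <- s) (1 - g c) ^+ 2)
      - (1 - lam) * lam ^+ 2 / 2 *
        ((\prod_(c <- s) v c) * \prod_(c <- s) ((1 + g c) * (1 - g c))))).
    by apply: eq_bigr => s _; rewrite /W /h !prodrXl big_split /=; field.
  rewrite !big_split /= !sumrN -!mulr_sumr !vS Ev3 Ev4 Ev5 -/X.
  rewrite (_ : _ - _ = lam ^+ 3 * (X - q)); last by rewrite /q; field.
  have l3 : 0 <= lam ^+ 3 by exact: exprn_ge0.
  rewrite normrM ger0_norm // ler_wpM2l // ler_norml.
  by move: X0 q0 q4; lra.
Qed.

End OneStep.

(** * Propagation of chi2-information *)

Section Reconstruction.
Variable R : realFieldType.
Implicit Types (lam : R) (D : nat -> R) (A B : seq (R * R)) (c : R * R).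
Implicit Types (Phi : R -> R -> R).

(** The squared magnetization weighted by the output probability [(x + y) / 2]; it is 0 at the
    origin. *)
Definition chi2 (x y : R) : R := (x - y) ^+ 2 / (2 * (x + y)).

(** Completing the square, with equality when [f] is the magnetization. Any test function thus gives
    a lower bound on the chi2-information. *)
Lemma chi2_ge (f x y : R) : 0 <= x -> 0 <= y ->
  f * (x - y) - f ^+ 2 * (x + y) / 2 <= chi2 x y.
Proof.
move=> x0 y0; rewrite /chi2; have [/eqP|xy] := eqVneq (x + y) 0.
  by rewrite paddr_eq0 // => /andP[/eqP-> /eqP->]; rewrite !(subrr, addr0, mulr0, mul0r, expr0n).
have xy0 : 0 < x + y by rewrite lt_neqAle eq_sym xy addr_ge0.
rewrite -subr_ge0 (_ : _ - _ = (x - y - f * (x + y)) ^+ 2 / (2 * (x + y))).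
  by rewrite divr_ge0 ?sqr_ge0 // mulr_ge0 // ltW.
by field.
Qed.

Lemma chi2_sublinear : sublinear chi2.
Proof.
split=> [x y x0 y0|w x y w0 x0 y0|x y x' y' x0 y0 x'0 y'0].
- by rewrite divr_ge0 ?sqr_ge0 // mulr_ge0 ?addr_ge0.
- rewrite /chi2; have [->|wn0] := eqVneq w 0.
    by rewrite !mul0r subrr expr0n mul0r.
  have [/eqP|xy] := eqVneq (x + y) 0.
    rewrite paddr_eq0 // => /andP[/eqP-> /eqP->].
    by rewrite !(subrr, addr0, mulr0, mul0r, expr0n).
  by field; rewrite xy -mulrDr mulf_neq0.
- have [/eqP|xy] := eqVneq (x + x' + (y + y')) 0.
    have s0 : 0 <= x + x' by exact: addr_ge0.
    have t0 : 0 <= y + y' by exact: addr_ge0.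
    rewrite paddr_eq0 // !paddr_eq0 // => /andP[/andP[/eqP-> /eqP->] /andP[/eqP-> /eqP->]].
    by rewrite /chi2 !(subrr, addr0, mulr0, mul0r, expr0n).
  (* At the magnetization of the merged pair, the two lower bounds add up to its chi2 exactly. *)
  pose f := (x + x' - (y + y')) / (x + x' + (y + y')).
  apply: le_trans (lerD (chi2_ge f x0 y0) (chi2_ge f x'0 y'0)).
  by rewrite le_eqVlt; apply/orP; left; apply/eqP; rewrite /chi2 /f; field.
Qed.

Definition magnetization c : R := (c.1 - c.2) / (c.1 + c.2).

Lemma magnetizationP c : nonneg_pair c ->
  [/\ (c.1 + c.2) * magnetization c = c.1 - c.2, chi2 c.1 c.2 = (c.1 - c.2) * magnetization c / 2 &
      `|magnetization c| <= 1].
Proof.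
move=> /andP[x0 y0]; rewrite /magnetization /chi2; have [/eqP|xy] := eqVneq (c.1 + c.2) 0.
  rewrite paddr_eq0 // => /andP[/eqP-> /eqP->].
  by rewrite !(subrr, addr0, mulr0, mul0r, expr0n, normr0, ler01).
have xy0 : 0 < c.1 + c.2 by rewrite lt_neqAle eq_sym xy addr_ge0.
split; [by field|by field|].
rewrite normrM normfV (gtr0_norm xy0) ler_pdivrMr // mul1r ler_norml.
by apply/andP; split; lra.
Qed.

(** The variational bound [chi2_ge] is summed over all outputs with the test function
    [e_1 / 2 - e_3 / 8] of the values [h]. *)
Lemma node_edge_chi2 A (a lam : R) m n
  (q := ((1 + a) ^+ m - (1 - a) ^+ m) / 2) :
  nonneg A -> swap_invariant A -> mass1 A = 1 -> chsum chi2 A = a -> 0 <= a <= 1 ->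
  0 <= lam <= 1 -> (200 <= n)%N -> n%:R * (lam ^+ 2 * q) = 4 / 3 ->
  n%:R * (lam ^+ 3 * 4 ^+ m) <= 1 / 200 ->
  61 / 100 <= chsum chi2 (node n (edge m lam A)).
Proof.
move=> A0 sA m1 Ja a01 l n200 nq nl; have /andP[l0 l1] := l.
have m2 : \sum_(c <- A) c.2 = 1 by rewrite -m1; exact: swap_mass.
have magn1 c : c \in A -> `|magnetization c| <= 1 by move=> /(allP A0) /magnetizationP[].
have swm : \sum_(c <- A) c.2 * magnetization c = - \sum_(c <- A) c.1 * magnetization c.
  rewrite sA -sumrN; apply: eq_bigr => c _ /=.
  by rewrite /magnetization /= [c.2 + c.1]addrC -(opprB c.1 c.2) mulNr mulrN.
have M1 : \sum_(c <- A) c.1 * magnetization c = a.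
  have : \sum_(c <- A) (c.1 - c.2) * magnetization c = 2 * a.
    rewrite -Ja /chsum mulr_sumr big_seq [RHS]big_seq.
    apply: eq_bigr => c /(allP A0) /magnetizationP[_ -> _].
    by field.
  under eq_bigr do rewrite mulrBl; rewrite sumrB swm; lra.
have Mv : \sum_(c <- A) ((c.1 + c.2) / 2) * magnetization c = 0.
  transitivity (\sum_(c <- A) 1 / 2 * (c.1 - c.2)).
    rewrite big_seq [RHS]big_seq; apply: eq_bigr => c /(allP A0) /magnetizationP[<- _ _]; ring.
  by rewrite -mulr_sumr sumrB m2 -/(mass1 A) m1 subrr mulr0.
have Mv2 : \sum_(c <- A) ((c.1 + c.2) / 2) * magnetization c ^+ 2 = a.
  rewrite -Ja /chsum big_seq [RHS]big_seq; apply: eq_bigr => c /(allP A0) /magnetizationP[e -> _].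
  by rewrite -e; ring.
have Sv : \sum_(c <- A) ((c.1 + c.2) / 2) = 1.
  by rewrite -mulr_suml big_split /= m2 -/(mass1 A) m1; field.
pose L := alltup m A.
pose h s : R :=
  lam * ((\prod_(c <- s) (1 + magnetization c) - \prod_(c <- s) (1 - magnetization c)) / 2).
have [P1 P2 P3] : [/\ \sum_(s <- L) (edgept lam s).1 = 1,
    \sum_(s <- L) (edgept lam s).1 * h s = lam ^+ 2 * q &
    `|\sum_(s <- L) (edgept lam s).1 * h s ^+ 2 - lam ^+ 2 * q| <= lam ^+ 3 * 4 ^+ m].
  apply: (@edge_moments _ _ A (fun c => c.1) (fun c => (c.1 + c.2) / 2) magnetization) => //.
  by move=> c /(allP A0) /andP[].
have hN s :
    lam * ((\prod_(c <- s) (1 + - magnetization c) - \prod_(c <- s) (1 - - magnetization c)) / 2) = - h s.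
  by under [X in _ - X]eq_bigr do rewrite opprK; rewrite /h; ring.
(* Given -, the same moments hold after changing the sign of the magnetization, which changes the
   sign of [h]. *)
have [N1 N2 N3] : [/\ \sum_(s <- L) (edgept lam s).2 = 1,
    \sum_(s <- L) (edgept lam s).2 * - h s = lam ^+ 2 * q &
    `|\sum_(s <- L) (edgept lam s).2 * (- h s) ^+ 2 - lam ^+ 2 * q| <= lam ^+ 3 * 4 ^+ m].
  under [X in X = lam ^+ 2 * q]eq_bigr do rewrite -hN.
  under [X in X - lam ^+ 2 * q]eq_bigr do rewrite -hN.
  apply: (@edge_moments _ _ A (fun c => c.2) (fun c => (c.1 + c.2) / 2)
    (fun c => - magnetization c)) => //.
  - by move=> c /(allP A0) /andP[].
  - by move=> c cA; rewrite normrN magn1.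
  - by under eq_bigr do rewrite mulrN; rewrite sumrN swm opprK.
  - by under eq_bigr do rewrite mulrN; rewrite sumrN Mv oppr0.
  - by under eq_bigr do rewrite sqrrN.
pose f ss := esym h 1 ss / 2 - esym h 3 ss / 8.
have beta_near (beta : R) : `|beta - lam ^+ 2 * q| <= lam ^+ 3 * 4 ^+ m ->
    `|n%:R * beta - 4 / 3| <= 1 / 200.
  move=> bl; rewrite -nq -mulrBr normrM normr_nat.
  by apply: le_trans nl; apply: ler_wpM2l.
have F1 := estimator_value P1 P2 erefl n200 nq (beta_near _ P3).
have F2 := estimator_value N1 N2 erefl n200 nq (beta_near _ N3).
rewrite /chsum /node /edge alltup_map !big_map.
pose X ss := \prod_(s <- ss) (edgept lam s).1.
pose Y ss := \prod_(s <- ss) (edgept lam s).2.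
have XY0 ss : ss \in alltup n L -> 0 <= X ss /\ 0 <= Y ss.
  have : all (fun s => nonneg_pair (edgept lam s)) L.
    by apply/allP => s sL; apply: nonneg_edgept => //; exact: all_alltup sL.
  move=> /all_alltup H /H /allP pos.
  by split; rewrite /X /Y big_seq prodr_ge0 // => s /pos /andP[].
apply: (@le_trans _ _ (\sum_(ss <- alltup n L)
    (f ss * (X ss - Y ss) - f ss ^+ 2 * (X ss + Y ss) / 2))); last first.
  rewrite big_seq [leRHS]big_seq; apply: ler_sum => ss /XY0[x0 y0].
  by rewrite /prodpt !big_map; exact: chi2_ge.
(* Since [f] is odd in [h], the bound is the average of two instances of [estimator_value], one for
   each label. *)
rewrite (_ : \sum_(_ <- _) _ =
  (wsum (fun s => (edgept lam s).1) n L (fun s => 2 * (esym h 1 s / 2 - esym h 3 s / 8)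
                                   - (esym h 1 s / 2 - esym h 3 s / 8) ^+ 2)
  + wsum (fun s => (edgept lam s).2) n L
      (fun s => 2 * (esym (fun x => - h x) 1 s / 2 - esym (fun x => - h x) 3 s / 8)
        - (esym (fun x => - h x) 1 s / 2 - esym (fun x => - h x) 3 s / 8) ^+ 2)) / 2).
  by move: F1 F2; lra.
rewrite /wsum -big_split mulr_suml; apply: eq_bigr => ss _ /=.
by rewrite -/(X ss) -/(Y ss) !esymN -/(esym _ _ _) /f; field.
Qed.

(* The output of A is erased with a suitable probability. *)
Lemma dilution A (a : R) : nonneg A -> swap_invariant A -> mass1 A = 1 ->
  0 < a -> a <= chsum chi2 A ->
  exists2 A', [/\ nonneg A', swap_invariant A', mass1 A' = 1 & chsum chi2 A' = a] &
    dominates A A'.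
Proof.
move=> A0 sA m1 a0 aJ; pose p := a / chsum chi2 A.
have J0 : 0 < chsum chi2 A by exact: lt_le_trans aJ.
have p0 : 0 <= p by rewrite divr_ge0 ?ltW.
have p1 : p <= 1 by rewrite ler_pdivrMr // mul1r.
have p1' : 0 <= 1 - p by rewrite subr_ge0.
pose A' := (1 - p, 1 - p) :: [seq scalept p c | c <- A].
have JA' Phi : sublinear Phi -> chsum Phi A' = (1 - p) * Phi 1 1 + p * chsum Phi A.
  move=> hP; rewrite /chsum big_cons big_map mulr_sumr -(sublinZ hP) // mulr1; congr (_ + _).
  rewrite big_seq [RHS]big_seq; apply: eq_bigr => c /(allP A0) /andP[c1 c2].
  by rewrite -(sublinZ hP).
exists A'; first split.
- apply/allP => c'; rewrite inE => /predU1P[->|/mapP[c /(allP A0) /andP[c1 c2] ->]].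
    by rewrite /nonneg_pair /= p1'.
  by apply/andP; split; exact: mulr_ge0.
- by move=> F; rewrite !big_cons !big_map /= [in LHS]sA.
- by rewrite /mass1 big_cons big_map /= -mulr_sumr -/(mass1 A) m1 mulr1 subrK.
- rewrite JA'; last exact: chi2_sublinear.
  rewrite /chi2 subrr expr0n mul0r mulr0 add0r -/chi2 /p mulfVK //.
  by rewrite gt_eqF.
move=> Phi hP; rewrite JA' //.
have := sublin_sum hP A0; rewrite m1 swap_mass // m1 => h1.
have := ler_wpM2l p1' h1; lra.
Qed.

(** Dilution reduces to chi2-information exactly 3/5, where [n] hyperedges give 61/100; further
    hyperedges only help. The loss from fewer than [n] hyperedges is affordable: 0.99 times 0.61
    exceeds 3/5. *)
Lemma chan_step_chi2 A lam D N m n (q := ((1 + 3 / 5) ^+ m - (1 - 3 / 5) ^+ m) / 2 : R) :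
  nonneg A -> swap_invariant A -> mass1 A = 1 -> 3 / 5 <= chsum chi2 A ->
  0 <= lam <= 1 -> (200 <= n)%N -> n%:R * (lam ^+ 2 * q) = 4 / 3 ->
  n%:R * (lam ^+ 3 * 4 ^+ m) <= 1 / 200 ->
  (forall i, 0 <= D i) -> (n <= N)%N -> 99 / 100 <= \sum_(n <= i < N) D i ->
  3 / 5 <= chsum chi2 (chan_step m lam D N A).
Proof.
move=> A0 sA m1 JA l n200 nq nl D0 nN hD.
have a0 : 0 < 3 / 5 :> R by lra.
have [A' [A'0 sA' m1' JA'] dom] := dilution A0 sA m1 a0 JA.
have V : 61 / 100 <= chsum chi2 (node n (edge m lam A)).
  apply: le_trans (node_edge_chi2 A'0 sA' m1' JA' _ l n200 nq nl) _; first by lra.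
  apply: dominates_node chi2_sublinear; rewrite ?nonneg_edge //.
  exact: dominates_edge.
rewrite chsum_step //; last exact: sublinZ chi2_sublinear.
have E0 : nonneg (edge m lam A) by exact: nonneg_edge.
have Em1 : mass1 (edge m lam A) = 1 by rewrite mass1_edge // m1 expr1n.
have Em2 : mass2 (edge m lam A) = 1.
  by rewrite swap_mass //; exact: swap_edge.
rewrite (@big_cat_nat _ _ _ n 0 N) //=.
have V1 : 0 <= \sum_(0 <= i < n) D i * chsum chi2 (node i (edge m lam A)).
  apply: sumr_ge0 => i _; apply: mulr_ge0 => //.
  by apply: (chsum_ge0 chi2_sublinear); exact: nonneg_node.
have V2 : \sum_(n <= i < N) D i * (61 / 100) <=
    \sum_(n <= i < N) D i * chsum chi2 (node i (edge m lam A)).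
  rewrite big_nat [leRHS]big_nat; apply: ler_sum => i /andP[ni _].
  by apply: ler_wpM2l => //; apply: le_trans V _; exact: (node_le chi2_sublinear).
by move: V1 V2 hD; rewrite -mulr_suml; lra.
Qed.

(* Same recursion as chan, but the mass lost by truncating the offspring law at N
   is kept as an uninformative output, so that the total mass is exactly 1. *)
Fixpoint padchan m lam D N k : seq (R * R) :=
  if k is k'.+1 then
    (1 - \sum_(0 <= i < N) D i, 1 - \sum_(0 <= i < N) D i)
      :: chan_step m lam D N (padchan m lam D N k')
  else [:: (1, 0); (0, 1)].

(** * The padded channel: unit mass, persistent chi2-information, comparison with [chan] *)

Section PaddedChannel.
Variables (m : nat) (lam : R) (D : nat -> R) (N : nat).
Hypotheses (l01 : 0 <= lam <= 1) (D0 : forall i, 0 <= D i).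
Hypothesis D1 : \sum_(0 <= i < N) D i <= 1.

Lemma nonneg_padchan k : nonneg (padchan m lam D N k).
Proof.
elim: k => [|k IH] /=; first by rewrite /nonneg /= /nonneg_pair /= ler01 lexx.
apply/andP; split; first by rewrite /nonneg_pair /= subr_ge0 D1.
exact: nonneg_step.
Qed.

Lemma swap_padchan k : swap_invariant (padchan m lam D N k).
Proof.
elim: k => [|k IH] F /=; first by rewrite !big_cons !big_nil !addr0 addrC.
by rewrite !big_cons /= [in LHS](swap_step m lam D N IH).
Qed.

Lemma mass1_padchan k : mass1 (padchan m lam D N k) = 1.
Proof.
elim: k => [|k IH]; first by rewrite /mass1 !big_cons big_nil /= !addr0.
rewrite /mass1 /= big_cons /= -/(mass1 _) mass1_step //.
- under [X in _ + X]eq_bigr do rewrite IH !expr1n mulr1.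
  by rewrite subrK.
- exact: nonneg_padchan.
- exact: swap_padchan.
Qed.

Lemma padchan_chi2 n k (q := ((1 + 3 / 5) ^+ m - (1 - 3 / 5) ^+ m) / 2 : R) :
  (200 <= n)%N -> n%:R * (lam ^+ 2 * q) = 4 / 3 ->
  n%:R * (lam ^+ 3 * 4 ^+ m) <= 1 / 200 ->
  (n <= N)%N -> 99 / 100 <= \sum_(n <= i < N) D i ->
  3 / 5 <= chsum chi2 (padchan m lam D N k).
Proof.
move=> n200 nq nl nN Dn; elim: k => [|k IH].
  rewrite /chsum /= !big_cons big_nil /chi2 /= !(subr0, add0r, addr0, sub0r); lra.
(* The padding pair has equal coordinates and contributes no chi2. *)
rewrite /chsum /= big_cons -/(chsum _ _) /= [chi2 _ _]/chi2 subrr expr0n mul0r add0r.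
exact: (chan_step_chi2 (nonneg_padchan k) (swap_padchan k)
  (mass1_padchan k) IH l01 n200 nq nl D0 nN Dn).
Qed.

(** Omitting the padding pair at every level only removes outputs. *)
Lemma chan_le_padchan k (G : R * R -> R) : (forall c, nonneg_pair c -> 0 <= G c) ->
  \sum_(c <- chan m lam D N k) G c <= \sum_(c <- padchan m lam D N k) G c.
Proof.
elim: k G => [|k IH] G G0 //=; rewrite big_cons.
rewrite -[leLHS]add0r lerD //; first by apply: G0; rewrite /nonneg_pair /= subr_ge0 D1.
have n1 := nonneg_chan m N k l01 D0; have n2 := nonneg_padchan k.
rewrite /chan_step !big_flatten !big_map; apply: ler_sum => n _; rewrite !big_map.
apply: (@ler_sum_alltup R _ (@nonneg_pair R) n (edge m lam (chan m lam D N k))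
  (edge m lam (padchan m lam D N k)) (fun s => G (scalept (D n) (prodpt s)))).
- exact: nonneg_edge.
- exact: nonneg_edge.
- move=> H H0; rewrite !big_map.
  apply: (@ler_sum_alltup R _ (@nonneg_pair R) m (chan m lam D N k)
    (padchan m lam D N k) (fun s => H (edgept lam s))) => // s s0.
  exact/H0/nonneg_edgept.
move=> s /nonneg_prod[p1 p2 _]; apply: G0.
by rewrite /nonneg_pair /= !mulr_ge0.
Qed.

Lemma mass1_chan_le1 k : 0 <= mass1 (chan m lam D N k) <= 1.
Proof.
rewrite -[X in _ <= _ <= X](mass1_padchan k); apply/andP; split.
  rewrite /mass1 big_seq sumr_ge0 // => c /(allP (nonneg_chan m N k l01 D0)).
  by move=> /andP[].
by apply: chan_le_padchan => c /andP[].
Qed.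

End PaddedChannel.

Lemma bernoulli_ineq (x : R) n : 0 <= x <= 1 -> 1 - n%:R * x <= (1 - x) ^+ n.
Proof.
move=> /andP[x0 x1]; elim: n => [|n IH]; first by rewrite mul0r subr0 expr0.
have x1' : 0 <= 1 - x by rewrite subr_ge0.
rewrite exprS; apply: le_trans (ler_wpM2l x1' IH).
rewrite -natr1; have := mulr_ge0 (mulr_ge0 (ler0n R n) x0) x0; lra.
Qed.

(** Half of [eta] pays for offspring numbers from [N1] on, the other half for the mass already lost
    at depth [k], amplified at most [m * N1] times. *)
Lemma mass1_chan_near1 m lam D k (eta : R) : 0 <= lam <= 1 ->
  (forall i, 0 <= D i) -> (forall N, \sum_(0 <= i < N) D i <= 1) ->
  (forall eps, 0 < eps -> exists N, 1 - eps <= \sum_(0 <= i < N) D i) ->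
  0 < eta ->
  exists N0, forall N, (N0 <= N)%N -> 1 - eta <= mass1 (chan m lam D N k).
Proof.
move=> l D0 D1 Dlim; elim: k eta => [|k IH] eta eta0.
  by exists 0%N => N _; rewrite /mass1 !big_cons big_nil /= !addr0; lra.
have eta2 : 0 < eta / 2 by lra.
have [N1 hN1] := Dlim _ eta2.
(* [K] bounds the exponents [m * i] in Bernoulli's inequality; the successor keeps it positive. *)
pose K : R := (m * N1).+1%:R.
have K0 : 0 < K by rewrite ltr0n.
have [N0 hN0] := IH (eta / 2 / K) (divr_gt0 eta2 K0).
exists (maxn N0 N1) => N; rewrite geq_max => /andP[/hN0 hZ N1N].
have /andP[Z0 Z1] := mass1_chan_le1 m l D0 (D1 N) k.
rewrite /= mass1_step //; [|exact: nonneg_chan|exact: swap_chan].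
set Z := mass1 _ in hZ Z0 Z1 *.
rewrite (@big_cat_nat _ _ _ N1 0 N) //=.
have T0 : 0 <= \sum_(N1 <= i < N) D i * (Z ^+ m) ^+ i.
  by apply: sumr_ge0 => i _; rewrite mulr_ge0 ?exprn_ge0.
have T1 : \sum_(0 <= i < N1) D i * (1 - eta / 2) <= \sum_(0 <= i < N1) D i * (Z ^+ m) ^+ i.
  rewrite big_nat [leRHS]big_nat; apply: ler_sum => i /andP[_ iN1].
  apply: ler_wpM2l => //; rewrite -exprM -[Z](subKr 1).
  apply: le_trans (bernoulli_ineq (m * i) _); last by lra.
  have iK : (m * i)%:R <= K by rewrite ler_nat ltnW // ltnS leq_mul2l ltnW ?orbT.
  have z1 : 0 <= 1 - Z by lra.
  have := ler_wpM2r z1 iK; have : K * (1 - Z) <= eta / 2.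
    by rewrite mulrC -ler_pdivlMr //; move: hZ; set u := eta / 2 / K; clear; lra.
  lra.
have [e2|e2] := leP (1 - eta / 2) 0.
  have : 0 <= \sum_(0 <= i < N1) D i * (Z ^+ m) ^+ i.
    by apply: sumr_ge0 => i _; rewrite mulr_ge0 ?exprn_ge0.
  lra.
move: T1; rewrite -mulr_suml; have := ler_wpM2r (ltW e2) hN1.
have := sqr_ge0 eta; lra.
Qed.

End Reconstruction.

(** * Hypertrees and channels *)

Section BooleanSequences.

Definition bseqs n := alltup n [:: true; false].

Lemma mem_bseqs n x : (x \in bseqs n) = (size x == n).
Proof.
by rewrite mem_alltup andb_idr // => _; apply/allP => -[] _; rewrite !inE.
Qed.

Lemma big_tuple_bseqs (V : nmodType) n (F : seq bool -> V) :
  \sum_(x : n.-tuple bool) F x = \sum_(x <- bseqs n) F x.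
Proof.
rewrite -(big_map (@tval n bool) xpredT) /=; apply: perm_big; apply: uniq_perm.
- by rewrite map_inj_uniq ?index_enum_uniq //; exact: val_inj.
- exact: alltup_uniq.
move=> x; rewrite mem_bseqs; apply/mapP/eqP => [[t _ ->]|sx].
  by rewrite size_tuple.
by exists (Tuple (introT eqP sx)); rewrite ?mem_index_enum.
Qed.

Lemma big_bseqsD (V : nmodType) a b (F : seq bool -> seq bool -> V) :
  \sum_(x <- bseqs (a + b)) F (take a x) (drop a x) =
  \sum_(x <- bseqs a) \sum_(x' <- bseqs b) F x x'.
Proof.
elim: a F => [|a IH] F.
  rewrite [RHS]big_seq1; apply: eq_bigr => x _.
  by rewrite take0 drop0.
rewrite addSn [RHS]big_alltupS [LHS]big_alltupS; apply: eq_bigr => x _ /=.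
exact: (IH (fun y z => F (x :: y) z)).
Qed.

Lemma size_blocks ns x : size (blocks ns x) = size ns.
Proof. by elim: ns x => //= n ns IH x; rewrite IH. Qed.

(** If the outputs of [A] are the labelled trees, then tuples of outputs are tuples of trees with
    one concatenated labelling, cut by [blocks]. *)
Lemma big_alltup_blocks (V : nmodType) (T C : Type) (nl : T -> nat)
    (g : T -> seq bool -> C) (A : seq C) (L : seq T) n (F : seq C -> V) :
  (forall G : C -> V, \sum_(c <- A) G c =
     \sum_(t <- L) \sum_(x <- bseqs (nl t)) G (g t x)) ->
  \sum_(cs <- alltup n A) F cs =
  \sum_(ts <- alltup n L) \sum_(x <- bseqs (sumn (map nl ts)))
     F [seq g p.1 p.2 | p <- zip ts (blocks (map nl ts) x)].
Proof.
move=> AL; elim: n F => [|n IH] F; first by rewrite /= !big_seq1.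
rewrite !big_alltupS AL; apply: eq_bigr => t _.
under eq_bigr do rewrite IH; rewrite exchange_big; apply: eq_bigr => ts _ /=.
by rewrite (big_bseqsD (nl t) _ (fun x y => F (g t x ::
  [seq g p.1 p.2 | p <- zip ts (blocks (map nl ts) y)]))).
Qed.

End BooleanSequences.

Section BigAll.
Variables (V : Type) (idx : V) (op : V -> V -> V).

Lemma eq_big_all (T : Type) (P : pred T) (A : seq T) (F G : T -> V) :
  all P A -> (forall x, P x -> F x = G x) ->
  \big[op/idx]_(x <- A) F x = \big[op/idx]_(x <- A) G x.
Proof.
move=> PA FG; elim: A PA => [|x A IH] /=; first by rewrite !big_nil.
by move=> /andP[Px /IH e]; rewrite !big_cons e FG.
Qed.

End BigAll.

Lemma all_alltup_size (T : Type) (P : pred T) n (A : seq T) :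
  all P A -> all (fun s => (size s == n) && all P s) (alltup n A).
Proof.
move=> PA; elim: n => //= n IH.
suff H B : all P B ->
    all (fun s => (size s == n.+1) && all P s) [seq x :: s | x <- B, s <- alltup n A].
  exact: H.
elim: B => //= x B IHB /andP[Px PB]; rewrite all_cat IHB // andbT all_map.
by apply: sub_all IH => s /= /andP[/eqP-> ->]; rewrite eqxx Px.
Qed.

Lemma all_zip1 (T U : Type) (P : pred T) (s : seq T) (u : seq U) :
  all P s -> all (fun p => P p.1) (zip s u).
Proof.
by elim: s u => [|x s IH] [|y u] //= /andP[-> /IH ->].
Qed.

(** * Outputs of [chan] as labelled trees *)

Section TreesAndChannels.
Variable R : realType.
Implicit Types (lam : R) (D : nat -> R).

(** The type [{classic htree}] supplies the equality needed for membership and uniqueness in lists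
    of trees. *)
Definition cnode (es : seq (seq {classic htree})) : {classic htree} := HNode es.

Lemma cnode_inj : injective cnode.
Proof. by move=> es es' []. Qed.

Fixpoint trees m N k : seq {classic htree} :=
  if k is k'.+1 then
    flatten [seq [seq cnode es | es <- alltup n (alltup m (trees m N k'))]
            | n <- iota 0 N]
  else [:: cnode [::]].

Lemma big_zip_fst (T U : Type) (F : T -> R) (s : seq T) (u : seq U) :
  size u = size s -> \prod_(p <- zip s u) F p.1 = \prod_(x <- s) F x.
Proof.
elim: s u => [|x s IH] [|y u] //= su; first by rewrite !big_nil.
by rewrite !big_cons IH //; case: su.
Qed.

Lemma kernel_uniform (T U : Type) (Q : T -> bool -> U -> R) (e : seq T) (bs : seq U) :
  size bs = size e ->
  \sum_(y <- bseqs (size e)) \prod_(p <- zip (zip e y) bs) Q p.1.1 p.1.2 p.2 =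
  \prod_(p <- zip e bs) (Q p.1 true p.2 + Q p.1 false p.2).
Proof.
elim: e bs => [|c e IH] [|b bs] //= => sbs; first by rewrite [LHS]big_seq1 !big_nil ?mulr1.
case: sbs => sbs; rewrite [LHS]big_alltupS !big_cons big_nil addr0 mulrDl -(IH bs) // !mulr_sumr.
by congr (_ + _); apply: eq_bigr => y _; rewrite big_cons.
Qed.

Lemma kernel_constant (T U : Type) (Q : T -> bool -> U -> R) (e : seq T) (bs : seq U)
    (s : bool) lam : size bs = size e ->
  \sum_(y <- bseqs (size e)) (if all (fun b => b == s) y then lam else 0) *
    \prod_(p <- zip (zip e y) bs) Q p.1.1 p.1.2 p.2 =
  lam * \prod_(p <- zip e bs) Q p.1 s p.2.
Proof.
elim: e bs => [|c e IH] [|b bs] //= => sbs; first by rewrite [LHS]big_seq1 !big_nil ?mulr1.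
case: sbs => sbs; move: (IH bs sbs) => {IH} IHs; rewrite [LHS]big_alltupS !big_cons big_nil addr0.
by case: s IHs => /= IHs; [rewrite addrC|];
  rewrite big1 ?add0r => [|y _]; rewrite ?mul0r //;
  rewrite mulrCA -IHs mulr_sumr; apply: eq_bigr => y _; rewrite big_cons mulrCA.
Qed.

(** The kernel mixes copying with uniform labels; summing out the children's labels produces the
    shape of [edgept]. *)
Lemma sum_Bker (T U : Type) (Q : T -> bool -> U -> R) r lam (e : seq T) (bs : seq U)
    (s : bool) : size e = r.-1 -> size bs = size e ->
  \sum_(y : (r.-1).-tuple bool)
     (Bker r lam s y * \prod_(p <- zip (zip e y) bs) Q p.1.1 p.1.2 p.2) =
  lam * \prod_(p <- zip e bs) Q p.1 s p.2 +
  (1 - lam) * \prod_(p <- zip e bs) ((Q p.1 true p.2 + Q p.1 false p.2) / 2).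
Proof.
move=> se sbs; rewrite (big_tuple_bseqs r.-1 (fun y : seq bool => Bker r lam s y *
  \prod_(p <- zip (zip e y) bs) Q p.1.1 p.1.2 p.2)) -se.
under [LHS]eq_bigr do rewrite /Bker mulrDl.
rewrite big_split /= kernel_constant //; congr (_ + _).
rewrite -mulr_sumr kernel_uniform // big_split /= -mulrA; congr (_ * _).
rewrite mulrC; congr (_ * _).
rewrite (@big_zip_fst _ _ (fun=> 2^-1)) // -se.
by elim: e {se sbs} => [|c e IH]; rewrite ?big_nil ?big_cons ?expr0 ?invr1 // exprS invfM IH.
Qed.

(** An output of the truncated channel is a bounded tree with a labelling of its leaves, and its
    pair is the joint likelihood. In the induction, tree weights factor out of each hyperedge by
    multilinearity. *)
Lemma chan_trees r lam D N k (F : R * R -> R) :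
  \sum_(c <- chan r.-1 lam D N k) F c =
  \sum_(t <- trees r.-1 N k) \sum_(x <- bseqs (nleaves k t))
     F (treeP D k t * condP r lam k t true x, treeP D k t * condP r lam k t false x).
Proof.
elim: k F => [|k IH] F.
  by rewrite /= !big_cons !big_nil /= !mul1r !addr0.
rewrite /= /chan_step !big_flatten !big_map; apply: eq_bigr => n _.
pose w := treeP D k; pose nl := nleaves k.
pose g t x := (w t * condP r lam k t true x, w t * condP r lam k t false x).
pose nlE e := sumn (map nl e).
pose gE e x := edgept lam [seq g p.1 p.2 | p <- zip e (blocks (map nl e) x)].
have E (G : R * R -> R) : \sum_(c <- edge r.-1 lam (chan r.-1 lam D N k)) G c =
    \sum_(e <- alltup r.-1 (trees r.-1 N k)) \sum_(x <- bseqs (nlE e)) G (gE e x).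
  by rewrite big_map (big_alltup_blocks (nl := nl) (g := g) (L := trees r.-1 N k)).
rewrite !big_map (big_alltup_blocks _ _ E).
apply: (eq_big_all _ _ (all_alltup_size n (all_alltup_size r.-1 (all_predT _)))).
move=> es /andP[/eqP ses es_size].
apply: eq_bigr => x _.
have gEE e y : size e = r.-1 ->
    gE e y = ((\prod_(c <- e) w c) * \sum_(z : (r.-1).-tuple bool)
       (Bker r lam true z * \prod_(p <- zip (zip e z) (blocks (map nl e) y))
            condP r lam k p.1.1 p.1.2 p.2),
      (\prod_(c <- e) w c) * \sum_(z : (r.-1).-tuple bool)
       (Bker r lam false z * \prod_(p <- zip (zip e z) (blocks (map nl e) y))
            condP r lam k p.1.1 p.1.2 p.2)).
  move=> se; have sb : size (blocks (map nl e) y) = size e.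
    by rewrite size_blocks size_map.
  rewrite !(sum_Bker (condP r lam k)) // /gE /edgept !big_map /=.
  rewrite -(big_zip_fst w sb) !mulrDr !(mulrCA _ lam) !(mulrCA _ (1 - lam)) -!big_split /=.
  by congr (_ + _ * _, _ + _ * _); apply: eq_bigr => p _; field.
have gEs s : \prod_(c <- [seq gE p.1 p.2 | p <- zip es (blocks (map nlE es) x)])
      (if s then c.1 else c.2) =
    (\prod_(e <- es) \prod_(c <- e) w c) * condP r lam k.+1 (HNode es) s x.
  rewrite big_map -(@big_zip_fst _ _ (fun e => \prod_(c <- e) w c) es (blocks (map nlE es) x));
    last by rewrite size_blocks size_map.
  rewrite /= -big_split /=; apply: (eq_big_all _ _ (all_zip1 _ es_size)).
  move=> [e y] /andP[/eqP se _].
  by rewrite -[LHS]/(if s then (gE e y).1 else (gE e y).2) gEE //; case: s.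
rewrite /scalept /prodpt /=; congr (F (_, _)).
- by have := gEs true; rewrite /= => ->; rewrite ses mulrA.
- by have := gEs false; rewrite /= => ->; rewrite ses mulrA.
Qed.

End TreesAndChannels.

(** * Mutual information *)

Section MutualInformation.
Variable R : realType.

(** The share of one output with likelihoods [x] and [y] in the mutual information, under the
    uniform prior. *)
Definition mi (x y : R) : R :=
  (if x == 0 then 0 else x / 2 * ln (x / ((x + y) / 2))) +
  (if y == 0 then 0 else y / 2 * ln (y / ((x + y) / 2))).

Lemma treeMI_mi r (lam : R) k t : treeMI r lam k t =
  \sum_(x <- bseqs (nleaves k t)) mi (condP r lam k t true x) (condP r lam k t false x).
Proof.
rewrite -(big_tuple_bseqs _ (fun x => mi (condP r lam k t true x) (condP r lam k t false x))).
by apply: eq_bigr => x _; rewrite big_bool.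
Qed.

Lemma miZ (w x y : R) : mi (w * x) (w * y) = w * mi x y.
Proof.
have [->|w0] := eqVneq w 0; first by rewrite /mi !mul0r eqxx addr0.
rewrite /mi !mulf_eq0 (negbTE w0) /= mulrDr !(fun_if ( *%R w)) !mulr0.
have E z : w * z / 2 * ln (w * z / ((w * x + w * y) / 2)) =
    w * (z / 2 * ln (z / ((x + y) / 2))).
  by rewrite -mulrDr -[w * (x + y) / 2]mulrA -mulf_div divff // mul1r !mulrA.
by rewrite !E.
Qed.

Lemma ln_ge_1BV (u : R) : 0 < u -> 1 - u^-1 <= ln u.
Proof.
move=> u0; have : ln (1 + (u^-1 - 1)) <= u^-1 - 1.
  by apply: le_ln1Dx; rewrite ltrBrDl subrr invr_gt0.
by rewrite addrC subrK lnV ?posrE //; lra.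
Qed.

(* Tangent lines of x |-> x ln (x / q); equality holds at rho = x / q. *)
Lemma xlnx_ge (x q rho : R) : 0 <= x -> 0 <= q -> (x != 0 -> 0 < q) -> 0 < rho ->
  (x * ln rho + x - q * rho) / 2 <= (if x == 0 then 0 else x / 2 * ln (x / q)).
Proof.
move=> x0 q0 xq rho0; case: eqVneq xq => [->|xn0] xq.
  by rewrite !mul0r !add0r mulNr oppr_le0 divr_ge0 ?mulr_ge0 // ltW.
have {xq}q1 := xq isT; have x1 : 0 < x by rewrite lt_neqAle eq_sym xn0.
have u0 : 0 < x / q / rho by rewrite !divr_gt0.
have := ln_ge_1BV u0; rewrite ln_div ?posrE ?divr_gt0 //.
rewrite -(ler_pM2l x1) (_ : x * (1 - _) = x - q * rho).
  by move: (ln _) (ln _) => a b; lra.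
by field; rewrite xn0 !gt_eqF.
Qed.

(** The log-sum inequality: both terms lie above their tangents at the ratio of the sums, and these
    tangents add up to the left-hand side. *)
Lemma xlnx_subadd (x x' q q' : R) : 0 <= x -> 0 <= x' -> 0 <= q -> 0 <= q' ->
  (x != 0 -> 0 < q) -> (x' != 0 -> 0 < q') ->
  (if x + x' == 0 then 0 else (x + x') / 2 * ln ((x + x') / (q + q'))) <=
  (if x == 0 then 0 else x / 2 * ln (x / q)) +
  (if x' == 0 then 0 else x' / 2 * ln (x' / q')).
Proof.
move=> x0 x'0 q0 q'0 xq xq'; have [/eqP|sn0] := eqVneq (x + x') 0.
  by rewrite paddr_eq0 // => /andP[/eqP-> /eqP->]; rewrite eqxx addr0.
have s0 : 0 < x + x' by rewrite lt_neqAle eq_sym sn0 addr_ge0.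
have Q0 : 0 < q + q'.
  have [xe|/xq q1] := eqVneq x 0; last by rewrite ltr_pwDl.
  by rewrite ltr_wpDl // xq' //; move: sn0; rewrite xe add0r.
have r0 : 0 < (x + x') / (q + q') by exact: divr_gt0.
apply: le_trans (lerD (xlnx_ge x0 q0 xq r0) (xlnx_ge x'0 q'0 xq' r0)).
rewrite le_eqVlt; apply/orP; left; apply/eqP; move: (ln _) => l.
by field; rewrite gt_eqF.
Qed.

Lemma mi_ge (x y rho rho' : R) : 0 <= x -> 0 <= y -> 0 < rho -> 0 < rho' ->
  (x * ln rho + y * ln rho' + x + y - (x + y) / 2 * (rho + rho')) / 2 <= mi x y.
Proof.
move=> x0 y0 r0 r0'; have q0 : 0 <= (x + y) / 2 by rewrite divr_ge0 ?addr_ge0.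
have qx : x != 0 -> 0 < (x + y) / 2.
  by move=> xn0; rewrite divr_gt0 // ltr_pwDl // lt_neqAle eq_sym xn0.
have qy : y != 0 -> 0 < (x + y) / 2.
  by move=> yn0; rewrite divr_gt0 // ltr_wpDl // lt_neqAle eq_sym yn0.
have := lerD (xlnx_ge x0 q0 qx r0) (xlnx_ge y0 q0 qy r0').
apply: le_trans; rewrite le_eqVlt; apply/orP; left; apply/eqP.
by field.
Qed.

Lemma mi_chi2 (x y : R) : 0 <= x -> 0 <= y -> chi2 x y / 4 <= mi x y.
Proof.
move=> x0 y0; have [/eqP|xy] := eqVneq (x + y) 0.
  rewrite paddr_eq0 // => /andP[/eqP-> /eqP->].
  by rewrite /chi2 /mi eqxx !(subrr, addr0, mul0r, expr0n).
have xy0 : 0 < x + y by rewrite lt_neqAle eq_sym xy addr_ge0.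
(* The optimal slopes are 1 plus or minus the magnetization; halving it keeps both slopes positive
   when [x] or [y] is 0, at the price of a constant factor. *)
pose u := (x - y) / (x + y) / 2.
have ub : -1 / 2 <= u <= 1 / 2.
  have /magnetizationP[_ _] : nonneg_pair (x, y) by rewrite /nonneg_pair /= x0.
  rewrite ler_norml /magnetization /= /u; set v := (x - y) / (x + y) => /andP[? ?].
  by apply/andP; split; lra.
have up : 0 < 1 + u by move: ub; lra.
have un : 0 < 1 - u by move: ub; lra.
apply: le_trans (mi_ge x0 y0 up un).
have := ler_wpM2l x0 (ln_ge_1BV up); have := ler_wpM2l y0 (ln_ge_1BV un).
set l := ln _; set l' := ln _ => h h'.
have e1 : 1 - (1 + u)^-1 = u / (1 + u) by field; rewrite gt_eqF.
have e2 : 1 - (1 - u)^-1 = - u / (1 - u) by field; rewrite gt_eqF.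
have : chi2 x y / 2 <= x * (1 - (1 + u)^-1) + y * (1 - (1 - u)^-1); last by lra.
rewrite e1 e2.
have xE : x = (x + y) / 2 * (1 + 2 * u) by rewrite /u; field.
have yE : y = (x + y) / 2 * (1 - 2 * u) by rewrite /u; field.
have -> : chi2 x y / 2 = (x + y) / 2 * (2 * u ^+ 2) by rewrite /chi2 /u; field.
have gen (s v : R) : 1 + v != 0 -> 1 - v != 0 -> s * (1 + 2 * v) * (v / (1 + v)) +
    s * (1 - 2 * v) * (- v / (1 - v)) = s * (2 * v ^+ 2 / ((1 + v) * (1 - v))).
  by move=> *; field; apply/andP.
rewrite [leRHS](_ : _ = (x + y) / 2 * (2 * u ^+ 2 / ((1 + u) * (1 - u)))); last first.
  by rewrite -gen ?gt_eqF // -xE -yE.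
rewrite ler_pM2l ?divr_gt0 //.
have u2 := sqr_ge0 u; have u2' : 0 <= 2 * u ^+ 2 by rewrite mulr_ge0.
rewrite ler_pdivlMr ?mulr_gt0 //; apply: ler_piMr => //; lra.
Qed.

Lemma mi_sublinear : sublinear mi.
Proof.
split=> [x y x0 y0|w x y _ _ _|x y x' y' x0 y0 x'0 y'0].
- apply: le_trans (mi_chi2 x0 y0); rewrite divr_ge0 //.
  exact: (sublin_ge0 (chi2_sublinear R)).
- exact: miZ.
have S (a b : R) : 0 <= a -> 0 <= b ->
    [/\ 0 <= (a + b) / 2, a != 0 -> 0 < (a + b) / 2 & b != 0 -> 0 < (a + b) / 2].
  move=> a0 b0; split=> [|an0|bn0]; first by rewrite divr_ge0 ?addr_ge0.
    by rewrite divr_gt0 // ltr_pwDl // lt_neqAle eq_sym an0.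
  by rewrite divr_gt0 // ltr_wpDl // lt_neqAle eq_sym bn0.
have [q0 qx qy] := S x y x0 y0; have [q'0 qx' qy'] := S x' y' x'0 y'0.
rewrite /mi (_ : (x + x' + (y + y')) / 2 = (x + y) / 2 + (x' + y') / 2); last by field.
have := lerD (xlnx_subadd x0 x'0 q0 q'0 qx qx') (xlnx_subadd y0 y'0 q0 q'0 qy qy').
by rewrite addrACA.
Qed.

End MutualInformation.

(** * The information of the model as a limit of truncated channels *)

Section Information.
Variable R : realType.
Implicit Types (lam : R) (D : nat -> R).
Local Open Scope classical_set_scope.

Lemma condP_ge0 r lam k t s x : 0 <= lam <= 1 -> 0 <= condP r lam k t s x.
Proof.
move=> /andP[l0 l1]; elim: k t s x => [|k IH] t s x /=; first exact: ler0n.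
apply: prodr_ge0 => ex _; apply: sumr_ge0 => y _; apply: mulr_ge0.
  rewrite /Bker addr_ge0 //; first by case: ifP.
  by rewrite divr_ge0 ?subr_ge0 ?exprn_ge0.
by apply: prodr_ge0 => p _; exact: IH.
Qed.

Lemma treeP_ge0 D k t : (forall i, 0 <= D i) -> 0 <= treeP D k t.
Proof.
move=> D0; elim: k t => [|k IH] t //=; apply: mulr_ge0 => //.
by apply: prodr_ge0 => e _; apply: prodr_ge0 => c _; exact: IH.
Qed.

Lemma treeMI_ge0 r lam k t : 0 <= lam <= 1 -> 0 <= treeMI r lam k t.
Proof.
move=> l; rewrite treeMI_mi; apply: sumr_ge0 => x _.
by apply: (sublin_ge0 (mi_sublinear R)); exact: condP_ge0.
Qed.

Lemma chsum_mi_chan r lam D N k : chsum (@mi R) (chan r.-1 lam D N k) =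
  \sum_(t <- trees r.-1 N k) treeP D k t * treeMI r lam k t.
Proof.
rewrite /chsum (chan_trees r lam D N k (fun c => mi c.1 c.2)); apply: eq_bigr => t _.
by rewrite treeMI_mi mulr_sumr; apply: eq_bigr => x _; rewrite /= miZ.
Qed.

Fixpoint bounded N k (t : htree) : bool :=
  if k is k'.+1 then (size (hedges t) < N)%N && all (all (bounded N k')) (hedges t)
  else true.

Lemma bounded_leq N N' k t : (N <= N')%N -> bounded N k t -> bounded N' k t.
Proof.
move=> NN'; elim: k t => //= k IH t /andP[/leq_trans -> //=].
by apply: sub_all => e; apply: sub_all => c; exact: IH.
Qed.

Lemma exists_bounded k t : exists N, bounded N k t.
Proof.
elim: k t => [|k IH] t; first by exists 0%N.
have H e : exists N, all (bounded N k) e.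
  elim: e => [|c e [N hN]]; first by exists 0%N.
  have [N' hN'] := IH c; exists (maxn N N') => /=.
  rewrite (bounded_leq (leq_maxr _ _) hN') /=.
  by apply: sub_all hN => c'; apply: bounded_leq (leq_maxl _ _).
have [N hN] : exists N, all (all (bounded N k)) (hedges t).
  elim: (hedges t) => [|e es [N hN]]; first by exists 0%N.
  have [N' hN'] := H e; exists (maxn N N') => /=; apply/andP; split.
    by apply: sub_all hN' => c; apply: bounded_leq (leq_maxr _ _).
  by apply: sub_all hN => e'; apply: sub_all => c; apply: bounded_leq (leq_maxl _ _).
exists (maxn N (size (hedges t)).+1) => /=; rewrite leq_max leqnn orbT /=.
by apply: sub_all hN => e'; apply: sub_all => c; apply: bounded_leq (leq_maxl _ _).
Qed.

Lemma mem_trees r N k (t : {classic htree}) :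
  (t \in trees r.-1 N k) = valid r k t && bounded N k t.
Proof.
elim: k t => [|k IH] [es] /=.
  by rewrite inE andbT; apply/eqP/nilP => [[->]|->].
have memE (e : seq {classic htree}) : (e \in alltup r.-1 (trees r.-1 N k)) =
    (size e == r.-1) && all (valid r k) e && all (bounded N k) e.
  rewrite mem_alltup -andbA -all_predI; congr (_ && _); apply: eq_all => c /=.
  exact: IH.
apply/flatten_mapP/idP => [[n]|].
  rewrite mem_iota add0n => /= nN; rewrite (mem_map cnode_inj).
  rewrite mem_alltup => /andP[/eqP-> h]; rewrite nN /=.
  by apply/andP; split; apply: sub_all h => e /=; rewrite memE => /andP[].
move=> /andP[v /andP[sN b]]; exists (size es); first by rewrite mem_iota.
rewrite (mem_map cnode_inj) mem_alltup eqxx /=.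
have : all (fun e : seq htree => ((size e == r.-1) && all (valid r k) e) &&
    all (bounded N k) e) es by rewrite (all_predI _ (all (bounded N k))) v.
by apply: sub_all => e /=; rewrite memE.
Qed.

Lemma trees_uniq m N k : uniq (trees m N k).
Proof.
elim: k => //= k IH; elim: N (trees m N k) IH => [|N IHN] T uT //.
rewrite -addn1 iotaD map_cat flatten_cat cat_uniq IHN //= cats0 add0n.
apply/andP; split; last first.
  by rewrite (map_inj_uniq cnode_inj); do 2!apply: alltup_uniq.
apply/hasPn => _ /mapP[es esN ->]; apply/negP => /flatten_mapP[n].
rewrite mem_iota add0n => /= nN; rewrite (mem_map cnode_inj).
move: esN nN; rewrite !mem_alltup => /andP[/eqP-> _] nN /andP[/eqP e _].
by move: nN; rewrite e ltnn.
Qed.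

(** The trees kept by the truncation form one of the finite sets whose sums [info] dominates. *)
Lemma info_ge r lam D N k : ((chsum (@mi R) (chan r.-1 lam D N k))%:E <= info r lam D k)%E.
Proof.
apply: esum_ge; exists [set` trees r.-1 N k].
  split; first exact: finite_seq.
  by move=> t /=; rewrite mem_trees => /andP[].
rewrite -fsbig_seq ?trees_uniq // chsum_mi_chan sumEFin //.
Qed.

(** A finite set of trees has a common bound on its offspring numbers, so some truncation contains
    it. *)
Lemma info_le r lam D k (M : \bar R) : 0 <= lam <= 1 -> (forall i, 0 <= D i) ->
  (forall N, ((chsum (@mi R) (chan r.-1 lam D N k))%:E <= M)%E) -> (info r lam D k <= M)%E.
Proof.
move=> l D0 JM; apply: ge_ereal_sup => _ [X [Xfin Xv] <-].
have [N XN] : exists N, forall t, X t -> bounded N k t.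
  have /finite_seqP[s Xs] := Xfin; rewrite Xs.
  elim: s {Xs} => [|t s [N hN]]; first by exists 0%N.
  have [N' hN'] := exists_bounded k t; exists (maxn N N') => t' /=.
  rewrite inE => /predU1P[->|/hN h]; first exact: bounded_leq (leq_maxr _ _) hN'.
  exact: bounded_leq (leq_maxl _ _) h.
apply: le_trans (JM N); rewrite chsum_mi_chan -sumEFin [leRHS]fsbig_seq ?trees_uniq //.
apply: lee_fsum_nneg_subset => //.
- move=> t /set_mem Xt; apply/mem_set => /=.
  by rewrite mem_trees XN // andbT; exact: Xv.
- by move=> t _; rewrite lee_fin mulr_ge0 ?treeP_ge0 ?treeMI_ge0.
Qed.

Lemma info_nonincreasing r lam D k : 0 <= lam <= 1 -> (forall i, 0 <= D i) ->
  (forall N, \sum_(0 <= i < N) D i <= 1) ->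
  (info r lam D k.+1 <= info r lam D k)%E.
Proof.
move=> l D0 D1; apply: info_le => // N; apply: le_trans (info_ge r lam D N k).
by rewrite lee_fin; apply: dominates_chan (mi_sublinear R).
Qed.

(** Monotonicity gives the limit. For the lower bound, [N] may depend on [k]: the padded channel
    carries at least 3/20, and padding accounts for at most 1/20 of it, leaving 1/10 at every
    depth. *)
Lemma reconstructibleP r lam D n
    (q := ((1 + 3 / 5) ^+ r.-1 - (1 - 3 / 5) ^+ r.-1) / 2 : R) :
  0 <= lam <= 1 -> (200 <= n)%N -> n%:R * (lam ^+ 2 * q) = 4 / 3 ->
  n%:R * (lam ^+ 3 * 4 ^+ r.-1) <= 1 / 200 ->
  (forall i, 0 <= D i) -> (forall N, \sum_(0 <= i < N) D i <= 1) ->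
  (forall eps, 0 < eps -> exists N, 1 - eps <= \sum_(0 <= i < N) D i) ->
  \sum_(0 <= i < n) D i <= 1 / 200 ->
  reconstructible r lam D.
Proof.
move=> l n200 nq nl D0 D1 Dlim Dn.
have cvgI : cvgn (info r lam D).
  apply: ereal_nonincreasing_is_cvgn; apply/nonincreasing_seqP => k.
  exact: info_nonincreasing.
exists (limn (info r lam D)); first exact: cvgI.
apply: (@lt_le_trans _ _ (1 / 10)%:E); first by rewrite lte_fin divr_gt0.
apply: lime_ge => //; apply: nearW => k.
pose M := mi 1 0 + mi 0 1 : R.
have M0 : 0 <= M by rewrite addr_ge0 ?(sublin_ge0 (mi_sublinear R)).
have e0 : 0 < 1 / 40 / (M + 1) by rewrite !divr_gt0 // ltr_wpDl.
have [N0 hN0] := mass1_chan_near1 r.-1 k l D0 D1 Dlim e0.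
have [N1 hN1] := Dlim (1 / 200) ltac:(lra).
pose N := maxn n (maxn N0 N1).
have hN : 1 - 1 / 200 <= \sum_(0 <= i < N) D i.
  apply: le_trans hN1 _.
  rewrite [leRHS](@big_cat_nat _ _ _ N1) //= ?leq_max ?leqnn ?orbT //.
  by rewrite lerDl sumr_ge0.
have nN : (n <= N)%N by rewrite leq_maxl.
have Dmid : 99 / 100 <= \sum_(n <= i < N) D i.
  by move: hN; rewrite (@big_cat_nat _ _ _ n 0 N) //=; lra.
have C := padchan_chi2 l D0 (D1 N) k n200 nq nl nN Dmid.
apply: le_trans (info_ge r lam D N k); rewrite lee_fin.
have P0 := nonneg_padchan r.-1 l D0 (D1 N) k.
have CJ : chsum (@chi2 R) (padchan r.-1 lam D N k) / 4 <= chsum (@mi R) (padchan r.-1 lam D N k).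
  rewrite /chsum mulr_suml big_seq [leRHS]big_seq; apply: ler_sum => c /(allP P0) /andP[? ?].
  exact: mi_chi2.
have hZ : 1 - 1 / 40 / (M + 1) <= mass1 (chan r.-1 lam D N k).
  by apply: hN0; rewrite !leq_max leqnn orbT.
(* [G] is nonnegative because full revelation is optimal. Comparing its sums over the two channels
   bounds the lost information by [2 * M] times the lost mass. *)
pose G c := M * (c.1 + c.2) - mi c.1 c.2 : R.
have G0 c : nonneg_pair c -> 0 <= G c.
  move=> /andP[c1 c2]; rewrite subr_ge0.
  have := dominates_full (mi_sublinear R) (A := [:: c]).
  rewrite /nonneg /= /nonneg_pair c1 c2 /chsum /mass1 /mass2 !big_seq1 => /(_ isT).
  move=> /le_trans; apply; rewrite /M.
  have m1 := sublin_ge0 (mi_sublinear R) ler01 (lexx 0).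
  have m2 := sublin_ge0 (mi_sublinear R) (lexx 0) ler01.
  have := mulr_ge0 c1 m2; have := mulr_ge0 c2 m1; lra.
have := chan_le_padchan r.-1 l D0 (D1 N) k G0.
have GE A : swap_invariant A -> \sum_(c <- A) G c = 2 * (M * mass1 A) - chsum (@mi R) A.
  move=> sA; rewrite /G sumrB -mulr_sumr big_split /= -/(mass1 A) -/(mass2 A).
  by rewrite swap_mass // /chsum; ring.
rewrite !GE; [|exact: swap_padchan|exact: swap_chan].
rewrite mass1_padchan //.
have : M * (1 - mass1 (chan r.-1 lam D N k)) <= 1 / 40.
  apply: (@le_trans _ _ (M * (1 / 40 / (M + 1)))).
    by apply: ler_wpM2l => //; move: hZ; set u := 1 / 40 / _; lra.
  by rewrite mulrA ler_pdivrMr ?ltr_wpDl //; lra.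
move: C CJ; set a := chsum _ _; set b := chsum _ _; set c := chsum _ _; set z := mass1 _.
lra.
Qed.

End Information.

(** * Point mass and Poisson offspring *)

Section OffspringLaws.
Variable R : realType.

Lemma sum_pointmass d n :
  \sum_(0 <= i < n) pointmass R d i = (d < n)%:R.
Proof.
elim: n => [|n IH]; first by rewrite big_geq.
rewrite big_nat_recr //= IH /pointmass ltnS [(d <= n)%N]leq_eqVlt -natrD eq_sym.
by case: ltngtP.
Qed.

Variable d : R.
Hypothesis d0 : 0 <= d.

Lemma poisson_ge0 i : 0 <= poisson d i.
Proof. by rewrite divr_ge0 ?mulr_ge0 ?exprn_ge0 ?expR_ge0. Qed.

Lemma sum_exp_le (x : R) N : 0 <= x -> \sum_(0 <= i < N) x ^+ i / (i`!)%:R <= expR x.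
Proof.
move=> x0; apply: (@nondecreasing_cvgn_le _ (series (exp_coeff x))).
  apply/nondecreasing_seqP => n; rewrite /series /= big_nat_recr //= lerDl.
  exact: exp_coeff_ge0.
exact: is_cvg_series_exp_coeff.
Qed.

Lemma sum_poisson N :
  \sum_(0 <= i < N) poisson d i = expR (- d) * \sum_(0 <= i < N) d ^+ i / (i`!)%:R.
Proof. by rewrite mulr_sumr; apply: eq_bigr => i _; rewrite /poisson mulrA. Qed.

Lemma sum_poisson_le1 N : \sum_(0 <= i < N) poisson d i <= 1.
Proof.
rewrite sum_poisson expRN mulrC ler_pdivrMr ?expR_gt0 // mul1r.
exact: sum_exp_le.
Qed.

Lemma sum_poisson_near1 (eps : R) : 0 < eps ->
  exists N, 1 - eps <= \sum_(0 <= i < N) poisson d i.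
Proof.
move=> e0; have lt : (1 - eps) * expR d < limn (series (exp_coeff d)).
  by rewrite -/(expR d) gtr_pMl ?expR_gt0 //; lra.
have [N _ /(_ N (leqnn N)) /= hN] := cvgr_gt _ (is_cvg_series_exp_coeff d) _ lt.
exists N; rewrite -/(expR d) in hN.
by rewrite sum_poisson expRN mulrC ler_pdivlMr ?expR_gt0 // ltW.
Qed.

(* Markov's inequality for 0.99^i. *)
Lemma sum_poisson_tail n : n%:R <= 98 / 100 * d -> 99 * 100 * 200 <= d ->
  \sum_(0 <= i < n) poisson d i <= 1 / 200.
Proof.
move=> nd dbig; rewrite sum_poisson.
have T : \sum_(0 <= i < n) d ^+ i / (i`!)%:R <=
    (100 / 99) ^+ n * \sum_(0 <= i < n) (99 / 100 * d) ^+ i / (i`!)%:R.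
  rewrite mulr_sumr big_nat [leRHS]big_nat; apply: ler_sum => i /andP[_ i_n].
  rewrite mulrA; apply: ler_wpM2r; first by rewrite invr_ge0.
  rewrite [leRHS](_ : _ = (100 / 99) ^+ (n - i) * d ^+ i); last first.
    rewrite -{1}(subnK (ltnW i_n)) exprD -mulrA -exprMn; congr (_ * _ ^+ _).
    by field.
  by rewrite ler_peMl ?exprn_ge0 // exprn_ege1 //; lra.
have x0 : 0 <= 99 / 100 * d by rewrite mulr_ge0 ?divr_ge0.
have e99 : (100 / 99) ^+ n <= expR (98 / 100 * d / 99).
  apply: (@le_trans _ _ (expR (n%:R * (1 / 99)))).
    rewrite expRM_natl; apply: lerXn2r; rewrite ?nnegrE ?divr_ge0 ?expR_ge0 //.
    by apply: le_trans (expR_ge1Dx _); lra.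
  by rewrite ler_expR; lra.
have {}T : \sum_(0 <= i < n) d ^+ i / (i`!)%:R <=
    expR (98 / 100 * d / 99 + 99 / 100 * d).
  rewrite expRD; apply: le_trans T _; apply: ler_pM => //.
  - by apply: sumr_ge0 => i _; rewrite divr_ge0 ?exprn_ge0.
  - exact: sum_exp_le.
(* The exponents balance: [98/9900 + 99/100 - 1 = -1/9900]. *)
apply: (@le_trans _ _ (expR (- (d / (99 * 100))))).
  apply: le_trans (ler_wpM2l (expR_ge0 _) T) _.
  by rewrite -expRD ler_expR; lra.
rewrite expRN -div1r ler_pdivrMr ?expR_gt0 //.
have := expR_ge1Dx (d / (99 * 100)).
have : 200 <= d / (99 * 100) by rewrite ler_pdivlMr //; lra.
lra.
Qed.

End OffspringLaws.

(** * Choice of the parameters *)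

Lemma edge_gain (R : realFieldType) m : (6 <= m)%N ->
  139 / 100 * m%:R <= ((1 + 3 / 5) ^+ m - (1 - 3 / 5) ^+ m) / 2 :> R.
Proof.
move=> /subnKC <-; elim: (m - 6)%N => [|k IH].
  (* The tight case [m = 6], that is [r = 7]: about 8.387 against 8.34. *)
  by rewrite addn0 !exprS expr0; lra.
rewrite addnS (exprS _ (6 + k)) [(1 - 3 / 5) ^+ _]exprS -[(6 + k).+1%:R]natr1.
have p : 0 <= (1 - 3 / 5) ^+ (6 + k) :> R by apply: exprn_ge0; lra.
have m6 : 6 <= (6 + k)%:R :> R by rewrite ler_nat leq_addr.
move: IH p m6; set x := _ ^+ _; set y := _ ^+ _; set z : R := (6 + k)%:R => *; lra.
Qed.

Theorem theorem4 (R : realType) (r : nat) (hr : (7 <= r)%N) :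
  exists d0 : R, forall d : R, d0 <= d ->
    exists lam : R, [/\ 0 <= lam <= 1,
      (r.-1)%:R * d * lam ^+ 2 < 1,
      (forall n : nat, d = n%:R -> reconstructible r lam (pointmass R n)) &
      reconstructible r lam (poisson d)].
Proof.
pose m := r.-1; have m6 : (6 <= m)%N by rewrite /m -ltnS prednK // (leq_trans _ hr).
(* Once [lam * K <= 1], the error term [n lam^3 4^m] is small; [n >= K ^+ 2] ensures this. *)
pose K : R := 200 * 4 ^+ m.
have K200 : 200 <= K.
  by rewrite /K -[leLHS]mulr1 ler_wpM2l // exprn_ege1 // ler1n.
exists (99 * 100 * 200 + 2 * K ^+ 2) => d dbig.
have K2 : 0 <= K ^+ 2 by exact: sqr_ge0.
have d1000 : 1000 <= d by lra.
have dbig' : 99 * 100 * 200 <= d by lra.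
have d0 : 0 <= d by lra.
(* Below [0.98 d], so that fewer than [n] hyperedges are unlikely; above [0.97 d], so that [lam]
   stays below the threshold. *)
have [n [nd1 nd2]] : exists n : nat, 97 / 100 * d <= n%:R /\ n%:R <= 98 / 100 * d.
  have h : 0 <= 97 / 100 * d by rewrite mulr_ge0 ?divr_ge0.
  have /andP[t1 t2] := truncn_itv h; exists (Num.truncn (97 / 100 * d)).+1.
  by split; [exact: ltW|rewrite -natr1; lra].
have n200 : (200 <= n)%N by rewrite -(ler_nat R); lra.
have nK : K ^+ 2 <= n%:R by lra.
have n0 : 0 < n%:R :> R by lra.
pose q : R := ((1 + 3 / 5) ^+ m - (1 - 3 / 5) ^+ m) / 2.
have qm : 139 / 100 * m%:R <= q := edge_gain R m6.
have m6' : 6 <= m%:R :> R by rewrite ler_nat.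
have q8 : 8 <= q by lra.
have q0 : 0 < q by lra.
have nq0 : 0 < n%:R * q by exact: mulr_gt0.
have y0 : 0 <= 4 / 3 / (n%:R * q) by rewrite !divr_ge0 // mulr_ge0 ?ltW.
pose lam : R := Num.sqrt (4 / 3 / (n%:R * q)).
have lam2 : lam ^+ 2 = 4 / 3 / (n%:R * q) by rewrite sqr_sqrtr.
have lam0 : 0 <= lam by exact: sqrtr_ge0.
have nq : n%:R * (lam ^+ 2 * q) = 4 / 3.
  by rewrite lam2; field; rewrite !gt_eqF.
have lamK : lam * K <= 1.
  have lK0 : 0 <= lam * K by apply: mulr_ge0 => //; lra.
  rewrite -(@ler_pXn2r _ 2) ?nnegrE //.
  rewrite exprMn expr1n lam2 mulrC mulrA (ler_pdivrMr _ _ nq0) mul1r.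
  by apply: ler_pM => //; lra.
have lam1 : lam <= 1.
  apply: le_trans lamK; rewrite ler_peMr //; lra.
have l01 : 0 <= lam <= 1 by rewrite lam0.
have nl : n%:R * (lam ^+ 3 * 4 ^+ m) <= 1 / 200.
  have -> : n%:R * (lam ^+ 3 * 4 ^+ m) = n%:R * (lam ^+ 2 * q) * (lam * K) / (200 * q).
    by rewrite /K; field; rewrite gt_eqF.
  have q200 : 0 < 200 * q by exact: mulr_gt0.
  rewrite nq (ler_pdivrMr _ _ q200); move: lamK q8; clear; lra.
exists lam; split=> //.
- rewrite lam2 mulrA (ltr_pdivrMr _ _ nq0) mul1r.
  have h1 : 0 <= 97 / 100 * d by rewrite mulr_ge0 ?divr_ge0.
  have h2 : 0 <= 139 / 100 * m%:R :> R by rewrite mulr_ge0 ?divr_ge0.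
  have md : 0 < m%:R * d by rewrite mulr_gt0 //; lra.
  (* This is [0.97 * 1.39 > 4/3]. *)
  have := ler_pM h1 h2 nd1 qm; lra.
- move=> k dk; apply: (reconstructibleP l01 n200 nq nl).
  + by move=> i; rewrite ler0n.
  + by move=> N; rewrite sum_pointmass; case: (_ < _)%N.
  + move=> eps e0; exists k.+1; rewrite sum_pointmass ltnSn /=; lra.
  + rewrite sum_pointmass ltnNge -(ler_nat R) -dk (_ : n%:R <= d) /=; first by lra.
    by lra.
apply: (reconstructibleP l01 n200 nq nl).
- exact: poisson_ge0.
- exact: sum_poisson_le1.
- exact: sum_poisson_near1.
- exact: sum_poisson_tail.
Qed.
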